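(* If $G$ is a planar graph with $g(G)\geq 7$ and $\Delta(G)\geq 6$, then $\chi^2_l(G)\leq \Delta(G)+3$.
   Context: All graphs are finite, simple and undirected. $\Delta(G)$ is the maximum degree of $G$, and $g(G)$ is the girth of $G$, i.e. the length of a shortest cycle (taken to be $+\infty$ if $G$ has no cycle). A 2-distance coloring of $G$ is a map on $V(G)$ assigning different colors to any two distinct vertices at distance at most 2. The 2-distance list chromatic number $\chi^2_l(G)$ is the smallest integer $k$ such that for every list assignment $L=\{L(v): v\in V(G)\}$ with $|L(v)|\geq k$ for all $v\in V(G)$, there is a 2-distance coloring $\phi$ of $G$ with $\phi(v)\in L(v)$ for all $v\in V(G)$. *)

(* Defs.v *)
From HB Require Import structures.
From mathcomp Require Import all_boot all_order all_algebra.
From mathcomp Require Import all_classical all_reals all_analysis.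

Set Implicit Arguments.
Unset Strict Implicit.
Unset Printing Implicit Defensive.

Import Order.TTheory GRing.Theory Num.Theory.
Import numFieldNormedType.Exports.

Local Open Scope classical_set_scope.
Local Open Scope ring_scope.

Record sgraph := SGraph {
  vertex :> finType;
  adj : rel vertex;
  adj_sym : symmetric adj;
  adj_irrefl : irreflexive adj }.

Definition degree (G : sgraph) (v : G) : nat := #|[pred w | adj v w]|.

Definition max_degree (G : sgraph) : nat := (\max_(v : G) degree v)%N.

(* The bound on the size excludes the sequences that [ucycle] accepts although
   they are not cycles: [::], and [:: u; v] with u and v adjacent. *)
Definition is_cycle (G : sgraph) (c : seq G) : Prop :=
  (2 < size c)%N /\ ucycle (@adj G) c.

(* Extended-real valued, since the infimum of the empty set is +oo. *)
Definition girth (R : realType) (G : sgraph) : \bar R :=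
  ereal_inf [set (size c)%:R%:E | c in [set c : seq G | is_cycle c]].

Definition dist_le (G : sgraph) (n : nat) (u v : G) : Prop :=
  exists p : seq G, [/\ path (@adj G) u p, last u p = v & (size p <= n)%N].

Definition two_distance_coloring (G : sgraph) (C : Type) (phi : G -> C) : Prop :=
  forall u v : G, u != v -> dist_le 2 u v -> phi u <> phi v.

(* Lists are finite and so is G, so finitely many colours occur in them. *)
Definition two_distance_choosable (G : sgraph) (k : nat) : Prop :=
  forall (C : finType) (L : G -> {set C}),
    (forall v, (k <= #|L v|)%N) ->
    exists2 phi : G -> C, two_distance_coloring phi & forall v, phi v \in L v.

Lemma two_distance_choosable_card (G : sgraph) : two_distance_choosable G #|G|.
Proof.
move=> C L HL.
suff [phi phiI phiL] : exists2 phi : G -> C,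
    {in enum G &, injective phi} & forall v, phi v \in L v.
  exists phi => // u v /eqP neq_uv _ /phiI eq_uv.
  by apply: neq_uv; apply: eq_uv; rewrite mem_enum.
have : (size (enum G) <= #|G|)%N by rewrite -cardE.
elim: (enum G) => [_|a s IHs /= lt_s].
  have /fin_all_exists[f fL] : forall v, exists c, c \in L v.
    move=> v; apply/set0Pn; rewrite -card_gt0.
    by apply: leq_trans (HL v); apply/card_gt0P; exists v.
  by exists f.
have [phi phiI phiL] := IHs (ltnW lt_s).
have [c cL cN] : exists2 c, c \in L a & c \notin map phi s.
  apply/subsetPn; apply: contraL (leq_trans lt_s (HL a)) => /subset_leq_card.
  by rewrite -leqNgt => /leq_trans; apply; rewrite -(size_map phi) card_size.
exists (fun v => if v == a then c else phi v) => [u v|v]; last first.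
  by case: eqP => [->|].
rewrite !inE; case: eqP => [->|_] /=; case: eqP => [-> //|_] /= us vs.
- by move=> e; rewrite e map_f in cN.
- by move=> e; rewrite -e map_f in cN.
- exact: phiI.
Qed.

Lemma two_distance_choosable_exists (G : sgraph) :
  exists k, `[< two_distance_choosable G k >].
Proof. by exists #|G|; apply/asboolP/two_distance_choosable_card. Qed.

Definition list_chromatic2 (G : sgraph) : nat :=
  ex_minn (two_distance_choosable_exists G).

(* [arc u v], restricted to [0, 1], draws the edge uv from [pos u] to [pos v];
   its values are irrelevant when u and v are not adjacent. *)
Record plane_drawing (R : realType) (G : sgraph)
    (pos : G -> R * R) (arc : G -> G -> R -> R * R) : Prop := PlaneDrawing {
  pos_inj : injective pos;
  arc_continuous : forall u v, adj u v -> {within `[0, 1], continuous (arc u v)};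
  arc_inj : forall u v, adj u v -> {in `[0, 1] &, injective (arc u v)};
  arc_start : forall u v, adj u v -> arc u v 0 = pos u;
  arc_end : forall u v, adj u v -> arc u v 1 = pos v;
  arc_rev : forall u v (t : R), adj u v -> t \in `[0, 1] ->
    arc v u t = arc u v (1 - t);
  arc_vertex : forall u v w (t : R), adj u v -> t \in `]0, 1[ -> arc u v t <> pos w;
  arc_arc : forall u v x y (s t : R), adj u v -> adj x y ->
    (x, y) != (u, v) -> (x, y) != (v, u) ->
    s \in `]0, 1[ -> t \in `]0, 1[ -> arc u v s <> arc x y t }.

Definition planar (R : realType) (G : sgraph) : Prop :=
  exists pos arc, @plane_drawing R G pos arc.

(* Main.v *)
(* The proof combines a discharging argument with a bound on the number of
   edges of a planar graph.

   Colouring.  In a smallest induced subgraph that is not colourable, no vertex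
   set [U] containing a vertex [c] with at most one neighbour outside [U] can be
   recoloured greedily after a colouring of the subgraph without [c].  This
   excludes enough configurations around vertices of degree at most 4 for the
   charges [75 d(v) - 210] to be moved along edges until all are nonnegative,
   so that the average degree is at least 14/5.

   Planarity.  A planar drawing becomes, on a fine square grid, a model of the
   graph as a minor of the grid: the vertices become the connected sets of grid
   points near the vertices and near the initial thirds of their arcs, and the
   middle thirds give walks joining them.  Over F_2 the cycle space of the grid
   is spanned by face boundaries covering every edge at most twice (MacLane), a
   property inherited by minors.  A basis of face boundaries together with its
   sum still covers every edge at most twice, and all of these are nonzero even
   edge sets, with at least 7 edges each when the girth is at least 7; this
   gives Euler's bound [7 (m - n + 2) <= 2 m], hence average degree less than
   14/5 in all subgraphs. *)

Require Import Defs.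
From mathcomp Require Import all_boot all_order all_algebra.
From mathcomp Require Import all_classical all_reals all_analysis.
From mathcomp Require Import zify ring lra.

Set Implicit Arguments.
Unset Strict Implicit.
Unset Printing Implicit Defensive.

(** * Greedy extension of colourings *)

Section Greedy.
Variables (T : finType) (e : rel T).
Hypotheses (e_sym : symmetric e) (e_irr : irreflexive e).
Implicit Types (S : {set T}) (u v w x y : T).

Definition nbs S v : {set T} := [set w in S | e v w].
Definition dg S v : nat := #|nbs S v|.
Definition sq_nbs S u : {set T} :=
  [set w in S | (w != u) && (e u w || [exists t in S, e u t && e t w])].

Lemma sq_nbsC S u w : u \in S -> w \in sq_nbs S u -> u \in sq_nbs S w.
Proof.
move=> uS; rewrite !inE uS => /and3P[wS wu] /orP[uw|/existsP[t /and3P[tS ut tw]]].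
  by rewrite eq_sym wu e_sym uw.
rewrite eq_sym wu; apply/orP; right; apply/existsP; exists t.
by rewrite tS e_sym tw e_sym ut.
Qed.

(** A neighbour [t] accounts for itself and for its neighbours other than [u]: exactly [dg S t]
    vertices. *)
Lemma card_sq_nbs S u : u \in S ->
  #|sq_nbs S u| <= \sum_(t in nbs S u) dg S t.
Proof.
move=> uS; have sub : sq_nbs S u \subset
    \bigcup_(t in nbs S u) (t |: (nbs S t :\ u)).
  apply/fintype.subsetP=> w; rewrite inE => /and3P[wS wu].
  case/orP=> [uw|/existsP[t /and3P[tS ut tw]]]; apply/bigcupP.
    by exists w; rewrite !inE ?wS ?eqxx.
  by exists t; rewrite !inE ?tS ?wu ?wS ?ut ?tw ?orbT.
apply: leq_trans (subset_leq_card sub) _.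
have -> : \sum_(t in nbs S u) dg S t =
    \sum_(t in nbs S u) #|t |: (nbs S t :\ u)|.
  apply: eq_bigr => t; rewrite inE => /andP[tS ut].
  rewrite cardsU1 !inE e_irr !andbF /= /dg (cardsD1 u (nbs S t)).
  by rewrite inE uS e_sym ut.
elim/big_rec2: _ => [|t n A _ le_n]; first by rewrite cards0.
by apply: leq_trans (leq_card_setU _ _) _; rewrite leq_add2l.
Qed.

Variables (C : finType) (L : T -> {set C}) (k : nat).
Hypothesis L_size : forall v, k < #|L v|.

Definition square_colors S (phi : T -> C) :=
  (forall v, phi v \in L v) /\
  forall u v, u \in S -> v \in sq_nbs S u -> phi u <> phi v.

Definition square_colorable S := exists phi, square_colors S phi.

(** The head is coloured first. The tail is still uncoloured at that time, so its vertices do not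
    count against the [k] colours that may be forbidden. *)
Fixpoint greedy S (U : seq T) :=
  if U is u :: U' then
    #|sq_nbs S u| <= k + count (mem (sq_nbs S u)) U' /\ greedy S U'
  else True.

(** The given colouring is erased on [U]. Outside [U] it stays proper when [c] is put back: two
    vertices joined only through [c] would both be neighbours of [c] outside [U]. The vertices of
    [U] are then coloured in order. *)
Lemma greedy_colorable S (U : seq T) (c : T) :
    uniq U -> {subset U <= S} -> c \in U -> #|nbs S c :\: [set x in U]| <= 1 ->
  square_colorable (S :\ c) -> greedy S U -> square_colorable S.
Proof.
move=> uniqU US cU cN [phi [phiL phiP]].
(* [V] holds the vertices still to be coloured; [psi] need only be proper outside it. *)
suff ext (V : seq T) psi : uniq V -> {subset V <= S} ->
    (forall v, psi v \in L v) ->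
    (forall u v, u \in S -> u \notin V -> v \notin V -> v \in sq_nbs S u ->
       psi u <> psi v) ->
    greedy S V -> square_colorable S.
  apply: (ext U phi) => // u v uS uU vU; rewrite inE => /and3P[vS vu uv].
  apply: phiP; rewrite !inE ?uS ?vS ?vu ?andbT.
    by apply: contraNneq uU => ->.
  have vc : v != c by apply: contraNneq vU => ->.
  rewrite vc /=; case/orP: uv => [->//|/existsP[t /and3P[tS ut tv]]].
  apply/orP; right; apply/existsP; exists t; rewrite !inE tS ut tv !andbT /=.
  apply: contraTneq cN => tc; rewrite -ltnNge; subst t.
  rewrite (cardsD1 u) (cardsD1 v (_ :\ u)) !inE uS vS vu uU vU e_sym ut tv /=.
  by [].
elim: V psi => [|u V IH] psi /=.
  by move=> _ _ psiL psiP _; exists psi; split=> // u v uS; apply: psiP.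
move=> /andP[uV uniqV] VS psiL psiP [ule gV].
have uS : u \in S by apply: VS; rewrite inE eqxx.
pose A := sq_nbs S u :\: [set x in V].
have cA : #|A| <= k.
  rewrite /A cardsD leq_subLR; apply: leq_trans ule _; rewrite addnC leq_add2r.
  rewrite -size_filter; set s := seq.filter _ _.
  have us : uniq s by rewrite filter_uniq.
  rewrite -(card_uniqP us); apply: subset_leq_card; apply/fintype.subsetP=> x.
  by rewrite mem_filter !inE => /andP[-> ->].
have [col colL colN] : exists2 col, col \in L u & col \notin psi @: A.
  apply/subsetPn; apply: contraTN (L_size u) => /subset_leq_card h.
  rewrite -leqNgt; apply: leq_trans h _.
  exact: leq_trans (leq_imset_card _ _) cA.
pose psi' v := if v == u then col else psi v.
apply: (IH psi') => //.
- by move=> v vV; apply: VS; rewrite inE vV orbT.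
- by move=> v; rewrite /psi'; case: eqP => [->|].
- move=> a b aS aV bV ab; rewrite /psi'.
  have bS : b \in S by move: ab; rewrite inE => /and3P[].
  case: (eqVneq a u) => [au|au]; case: (eqVneq b u) => [bu|bu].
  + by move: ab; rewrite au bu inE eqxx andbF.
  + move=> h; case/negP: colN; rewrite h; apply: imset_f.
    by rewrite /A inE inE bV -au ab.
  + move=> h; case/negP: colN; rewrite -h; apply: imset_f.
    by rewrite /A inE inE aV /= -bu sq_nbsC.
  + by apply: psiP; rewrite // inE negb_or ?au ?bu.
Qed.

End Greedy.

(** * Reducible configurations and discharging *)

Arguments greedy : simpl never.

Ltac nat_lia := repeat match goal with
  | H : is_true (leq _ _) |- _ => revert H
  | H : @eq _ ?a _ |- _ => let _ := constr:(a : nat) in revert H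
  | H : @eq bool (leq _ _) _ |- _ => revert H
  | H : @eq bool (@eq_op _ ?a _) _ |- _ => let _ := constr:(a : nat) in revert H
  | H : is_true (@eq_op _ ?a _) |- _ => let _ := constr:(a : nat) in revert H
  | H : is_true (~~ @eq_op _ ?a _) |- _ => let _ := constr:(a : nat) in revert H
  end; clear; intros; lia.

Section Reducible.
Variables (T : finType) (e : rel T).
Hypotheses (e_sym : symmetric e) (e_irr : irreflexive e).
Variables (C : finType) (L : T -> {set C}) (D : nat) (S : {set T}).
Hypotheses (D_ge6 : 6 <= D) (dg_le : forall v, dg e S v <= D).
Hypothesis L_size : forall v, D + 2 < #|L v|.
Hypothesis S_min : forall c, c \in S -> square_colorable e L (S :\ c).
Hypothesis S_bad : ~ square_colorable e L S.
Hypothesis no_triangle : forall x y z, e x y -> e y z -> e z x = false.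

Local Notation N := (nbs e S).
Local Notation d := (dg e S).
Local Notation near u w := (w \in sq_nbs e S u).

Definition nb_seq v s := uniq s /\ N v =i s.

(** For a neighbour [x] of a 2-vertex [v] this is the degree of the other neighbour of [v]; the sum
    avoids naming it. *)
Definition other_dg x v := \sum_(t in N v :\ x) d t.

Lemma nb_seq_sum v s (F : T -> nat) : nb_seq v s ->
  \sum_(t in N v) F t = \sum_(t <- s) F t.
Proof.
case=> us Ns; rewrite big_uniq //=; apply: eq_bigl => t; exact: Ns.
Qed.

Lemma nb_seqE v s : nb_seq v s -> forall t, t \in s -> t \in S /\ e v t.
Proof. by case=> _ Ns t; rewrite -Ns inE => /andP. Qed.

Lemma nb_seq_perm v s s' : perm_eq s s' -> nb_seq v s -> nb_seq v s'.
Proof.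
move=> ss' [us Ns]; split; first by rewrite -(perm_uniq ss').
by move=> t; rewrite Ns (perm_mem ss').
Qed.

Lemma nb_seq_exists (p : pred T) v : exists s1 s2,
  [/\ nb_seq v (s1 ++ s2), all p s1, all (predC p) s2 & size s1 + size s2 = d v].
Proof.
exists (seq.filter p (enum (N v))), (seq.filter (predC p) (enum (N v))).
have pe := permEl (perm_filterC p (enum (N v))).
split; rewrite ?filter_all //; last first.
  by rewrite -size_cat (perm_size pe) -cardE.
apply: nb_seq_perm (_ : nb_seq v (enum (N v))); first by rewrite perm_sym.
by split=> [|t]; rewrite ?enum_uniq ?mem_enum.
Qed.

Lemma other_dgE x v : x \in S -> v \in S -> e x v ->
  \sum_(t in N v) d t = d x + other_dg x v.
Proof.
move=> xS vS xv; rewrite (bigD1 x) /=; last by rewrite inE xS e_sym.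
by congr addn; apply: eq_bigl => t; rewrite [RHS]in_setD1 andbC.
Qed.

Lemma card_nbs2 x v : x \in S -> v \in S -> e x v -> d v = 2 -> #|N v :\ x| = 1.
Proof.
move=> xS vS xv; rewrite /dg (cardsD1 x) inE xS e_sym xv /=.
by case.
Qed.

Lemma other_dg_le x v : x \in S -> v \in S -> e x v -> d v = 2 ->
  other_dg x v <= D.
Proof.
move=> xS vS xv /(card_nbs2 xS vS xv)/eqP/cards1P[w Nw].
by rewrite /other_dg Nw big_set1.
Qed.

Lemma nearA u w : u \in S -> w \in S -> e u w -> near u w.
Proof.
move=> uS wS uw; rewrite inE wS uw andbT /=.
by apply: contraTneq uw => ->; rewrite e_irr.
Qed.

Lemma nearB t u w : t \in S -> u \in S -> w \in S -> e t u -> e t w -> u != w ->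
  near u w.
Proof.
move=> tS uS wS tu tw uw; rewrite inE wS eq_sym uw /=; apply/orP; right.
by apply/existsP; exists t; rewrite tS e_sym tu.
Qed.

(* A vertex [c] of degree 2 with a neighbour in [U] joins no two vertices outside
   [U], so its removal keeps all the constraints between them. *)
Lemma greedy_absurd U c x : uniq U -> all (mem S) U -> c \in U -> x \in U ->
  e x c -> d c = 2 -> greedy e (D + 2) S U -> False.
Proof.
move=> uU /allP US cU xU xc dc gU; apply: S_bad.
have [cS xS] := (US _ cU, US _ xU).
apply: (@greedy_colorable _ _ e_sym _ _ _ L_size S U c) => //;
  last exact: S_min.
rewrite -(card_nbs2 xS cS xc dc); apply: subset_leq_card.
apply/fintype.subsetP => t; rewrite inE [t \in [set _ in U]]inE => /andP[tU tN].
have tx : t != x by apply: contraNneq tU => ->.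
by rewrite in_setD1 tx.
Qed.

Lemma greedy_step u U : u \in S ->
  \sum_(t in N u) d t <= D + 2 + count (fun w => near u w) U ->
  greedy e (D + 2) S U -> greedy e (D + 2) S (u :: U).
Proof.
by move=> uS le_sum gU; split=> //; apply: leq_trans le_sum; apply: card_sq_nbs.
Qed.

(** A vertex of degree at most 1 sees at most [D] vertices and joins no two others, so it can be
    removed and coloured last. *)
Lemma dg_ge2 v : v \in S -> 2 <= d v.
Proof.
move=> vS; rewrite leqNgt; apply/negP => dv; apply: S_bad.
apply: (@greedy_colorable _ _ e_sym _ _ _ L_size S [:: v] v) => //.
- by move=> u; rewrite inE => /eqP->.
- by rewrite inE.
- by apply: leq_trans (subset_leq_card (subsetDl _ _)) _; rewrite -ltnS.
- exact: S_min.
apply: greedy_step => //=.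
have : \sum_(t in N v) d t <= \sum_(t in N v) D by apply: leq_sum.
rewrite sum_nat_const -/(d v); have : d v * D <= 1 * D by rewrite leq_mul2r -ltnS dv orbT.
lia.
Qed.

Lemma no_adjacent_2vertices u v : u \in S -> v \in S -> e u v ->
  d u = 2 -> d v = 2 -> False.
Proof.
move=> uS vS uv du dv; have vu : e v u by rewrite e_sym.
apply: (@greedy_absurd [:: u; v] v u) => //=; rewrite ?inE ?eqxx ?orbT ?uS ?vS ?andbT //.
  by apply: contraTneq uv => ->; rewrite e_irr.
have [ou ov] := (other_dg_le uS vS uv dv, other_dg_le vS uS vu du).
apply: greedy_step => //; first by rewrite (other_dgE _ _ vu) //=; nat_lia.
by apply: greedy_step => //; rewrite (other_dgE _ _ uv) //=; nat_lia.
Qed.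


Lemma nb_seq3 u a b c : nb_seq u [:: a; b; c] ->
  [/\ [/\ a != b, a != c & b != c], [/\ a \in S, b \in S & c \in S],
      [/\ e u a, e u b & e u c] & \sum_(t in N u) d t = d a + d b + d c].
Proof.
move=> Nu; rewrite (nb_seq_sum _ Nu) !big_cons big_nil addn0 addnA.
have /= nbu := nb_seqE Nu; have [/= + _] := Nu.
rewrite !inE !negb_or andbT => /andP[/andP[ab ac] bc].
have [[aS ua] [bS ub] [cS uc]] : [/\ a \in S /\ e u a, b \in S /\ e u b & c \in S /\ e u c].
  by split; apply: nbu; rewrite !inE eqxx ?orbT.
by [].
Qed.

Lemma nb_seq4 u a b c f : nb_seq u [:: a; b; c; f] ->
  [/\ [/\ a != b, a != c, a != f, b != c & (b != f) && (c != f)],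
      [/\ a \in S, b \in S, c \in S & f \in S],
      [/\ e u a, e u b, e u c & e u f] &
      \sum_(t in N u) d t = d a + d b + d c + d f].
Proof.
move=> Nu; rewrite (nb_seq_sum _ Nu) !big_cons big_nil addn0 !addnA.
have /= nbu := nb_seqE Nu; have [/= + _] := Nu.
rewrite !inE !negb_or andbT => /and3P[/and3P[ab ac af] /andP[bc bf] cf].
have [[aS ua] [bS ub] [cS uc] [fS uf]] :
    [/\ a \in S /\ e u a, b \in S /\ e u b, c \in S /\ e u c & f \in S /\ e u f].
  by split; apply: nbu; rewrite !inE eqxx ?orbT.
by rewrite bf.
Qed.

Lemma e_neq x y : e x y -> x != y.
Proof. by apply: contraTneq => ->; rewrite e_irr. Qed.

Ltac nears := repeat match goal with
  | |- context [nat_of_bool ?b] =>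
     rewrite (_ : b = true);
       [|solve [apply: nearA => //; rewrite // e_sym //
               |match goal with H : is_true (e ?t _), K : is_true (e ?t _) |- _ =>
                  apply: (nearB (t := t)) => //; rewrite // eq_sym // end]];
     change (nat_of_bool true) with 1%N
  end.

Ltac step := apply: greedy_step => //=; [nears|..].


Lemma nb_seq_dg u s : nb_seq u s -> d u = size s.
Proof. by case=> us Ns; rewrite /dg (eq_card Ns) (card_uniqP us). Qed.

Ltac sums H := match type of H with is_true (e ?x ?v) =>
  rewrite (@other_dgE x v) //; nat_lia end.

(** A 2-neighbour sees at most [3 + D] vertices, one too many, but [u] is still uncoloured at its
    turn. Last comes [u], which sees at most 6. *)
Lemma no_3vertex_111 u a b c : u \in S -> nb_seq u [:: a; b; c] ->
  d a = 2 -> d b = 2 -> d c = 2 -> False.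
Proof.
move=> uS Nu da db dc; have /= dU := nb_seq_dg Nu.
have [[ab ac bc] [aS bS cS] [ua ub uc] du] := nb_seq3 Nu.
have [[oa ob] oc] := (other_dg_le uS aS ua da, other_dg_le uS bS ub db, other_dg_le uS cS uc dc).
apply: (@greedy_absurd [:: a; b; c; u] a u) => //=; rewrite ?inE ?eqxx ?orbT //.
- by rewrite !negb_or ab ac bc ?[_ == u]eq_sym !e_neq.
- by rewrite aS bS cS uS.
step; first by sums ua.
step; first by sums ub.
step; first by sums uc.
by step; nat_lia.
Qed.

(** If a bound failed, some vertex would see at most [8 <= D + 2] vertices and could be coloured
    last: [a] for the first bound, [u] for the second. *)
Lemma vertex3_11 u a b x : u \in S -> nb_seq u [:: a; b; x] ->
  d a = 2 -> d b = 2 -> 6 <= other_dg u a /\ 5 <= d x.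
Proof.
move=> uS Nu da db; have /= dU := nb_seq_dg Nu.
have [[ab ax bx] [aS bS xS] [ua ub ux] du] := nb_seq3 Nu.
have [oa ob] := (other_dg_le uS aS ua da, other_dg_le uS bS ub db).
have dx := dg_le x.
split; rewrite leqNgt; apply/negP => h.
- apply: (@greedy_absurd [:: u; b; a] a u) => //=; rewrite ?inE ?eqxx ?orbT //.
  + by rewrite !negb_or [b == a]eq_sym ab !e_neq.
  + by rewrite aS bS uS.
  step; first by nat_lia.
  step; first by sums ub.
  by step; sums ua.
- apply: (@greedy_absurd [:: a; b; u] a u) => //=; rewrite ?inE ?eqxx ?orbT //.
  + by rewrite !negb_or ab ?[_ == u]eq_sym !e_neq.
  + by rewrite aS bS uS.
  step; first by sums ua.
  step; first by sums ub.
  by step; nat_lia.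
Qed.

(** If [d x + d y <= 6], then [u] sees at most 8 vertices and is coloured last. If the sum is 7, the
    order is reversed: [v] sees at most [3 + 5] vertices. *)
Lemma vertex3_1 u v x y : u \in S -> nb_seq u [:: v; x; y] -> d v = 2 ->
  7 <= d x + d y /\ (other_dg u v <= 5 -> 8 <= d x + d y).
Proof.
move=> uS Nu dv; have /= dU := nb_seq_dg Nu.
have [_ [vS _ _] [uv _ _] du] := nb_seq3 Nu.
have ov := other_dg_le uS vS uv dv.
split=> [|ov5]; rewrite leqNgt; apply/negP => h.
- apply: (@greedy_absurd [:: v; u] v u) => //=; rewrite ?inE ?eqxx ?orbT //.
  + by rewrite eq_sym !e_neq.
  + by rewrite vS uS.
  step; first by sums uv.
  by step; nat_lia.
- apply: (@greedy_absurd [:: u; v] v u) => //=; rewrite ?inE ?eqxx ?orbT //.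
  + by rewrite !e_neq.
  + by rewrite vS uS.
  step; first by nat_lia.
  by step; sums uv.
Qed.

(** Otherwise [a] sees at most [4 + 5] vertices, one of them the uncoloured [x], so [a] can be last
    but one. The other 2-neighbours see at most [4 + D], at least two of them uncoloured. *)
Lemma vertex4_1111 x a b c f : x \in S -> nb_seq x [:: a; b; c; f] ->
  d a = 2 -> d b = 2 -> d c = 2 -> d f = 2 -> 6 <= other_dg x a.
Proof.
move=> xS Nx da db dc df; have /= dX := nb_seq_dg Nx.
have [[ab ac af bc /andP[bf cf]] [aS bS cS fS] [xa xb xc xf] dx] := nb_seq4 Nx.
have [ob oc] := (other_dg_le xS bS xb db, other_dg_le xS cS xc dc).
have of_ := other_dg_le xS fS xf df.
rewrite leqNgt; apply/negP => h.
apply: (@greedy_absurd [:: b; c; f; a; x] a x) => //=; rewrite ?inE ?eqxx ?orbT //.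
- by rewrite !negb_or bc bf cf ![_ == a]eq_sym ab ac af ![_ == x]eq_sym !e_neq.
- by rewrite aS bS cS fS xS.
step; first by sums xb.
step; first by sums xc.
step; first by sums xf.
step; first by sums xa.
by step; nat_lia.
Qed.

(** [y] and [x] see at most 10 and 9 vertices, so they fit before a last vertex that sees at most 8:
    [z] if its other neighbour has degree at most 5, or [a] if its other neighbour has degree at
    most 4. *)
Lemma vertex4_111 x a b c y z t : x \in S ->
  nb_seq x [:: a; b; c; y] -> nb_seq y [:: x; z; t] ->
  d a = 2 -> d b = 2 -> d c = 2 -> d z = 2 -> d t <= 4 ->
  other_dg x a <= 5 -> other_dg x b <= 5 -> other_dg x c <= 5 ->
  6 <= other_dg y z /\ other_dg x a = 5.
Proof.
move=> xS Nx Ny da db dc dz dt oa ob oc; have /= dX := nb_seq_dg Nx.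
have /= dY := nb_seq_dg Ny.
have [[ab ac ay bc /andP[bY cy]] [aS bS cS yS] [xa xb xc xy] dx] := nb_seq4 Nx.
have [[xz _ _] [_ zS _] [yx yz _] dy] := nb_seq3 Ny.
have oz := other_dg_le yS zS yz dz.
(* A common neighbour [z] of [x] and [y] would close a triangle. *)
have zN v : e x v -> z != v.
  move=> xv; apply/eqP => zv; subst v.
  by have := no_triangle yx xv; rewrite e_sym yz.
split; last apply/eqP; [rewrite leqNgt|rewrite eqn_leq oa leqNgt]; apply/negP => h.
- apply: (@greedy_absurd [:: y; a; b; c; x; z] z y) => //=; rewrite ?inE ?eqxx ?orbT //.
  + rewrite !negb_or ![y == _]eq_sym ay bY cy ab ac bc xz ![_ == z]eq_sym !zN //.
    by rewrite ![_ == x]eq_sym !e_neq // e_sym.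
  + by rewrite aS bS cS yS xS zS.
  step; first by nat_lia.
  step; first by sums xa.
  step; first by sums xb.
  step; first by sums xc.
  step; first by nat_lia.
  by step; sums yz.
- apply: (@greedy_absurd [:: z; y; b; c; x; a] a x) => //=; rewrite ?inE ?eqxx ?orbT //.
  + rewrite !negb_or [z == x]eq_sym xz !zN // ![y == _]eq_sym ay bY cy.
    rewrite [b == a]eq_sym [c == a]eq_sym ab ac bc (e_neq xy).
    by rewrite ![_ == x]eq_sym !e_neq.
  + by rewrite aS bS cS yS xS zS.
  step; first by sums yz.
  step; first by nat_lia.
  step; first by sums xb.
  step; first by sums xc.
  step; first by nat_lia.
  by step; sums xa.
Qed.


(** A 2-vertex has charge -60. If its other neighbour pays 40 or 33, the remainder is 20 or 27;
    otherwise each side pays half. *)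
Definition demand2 x t :=
  if 6 <= other_dg x t then 20 else if 5 <= other_dg x t then 27 else 30.

(** A 3-vertex has charge 15 and owes up to 30 to a 2-neighbour. With no neighbour of degree at
    least 5, [vertex3_1] gives it two 4-neighbours, paying 8 each, or else it owes only 20 and has
    at least one, paying 5. *)
Definition demand3 t :=
  if [exists w in N t, 5 <= d w] then 0
  else if [exists z in N t, (d z == 2) && (other_dg t z <= 5)] then 8
  else if [exists z in N t, d z == 2] then 5 else 0.

(* The charge of [v] is 15 (5 d(v) - 14) = 75 d(v) - 210, of which [gift v t] is
   sent to each neighbour [t]: vertices of degree at least 5 pay a fixed amount,
   the others just enough to leave [t] with a nonnegative charge. *)
Definition gift x t :=
  if 6 <= d x then 40 else if d x == 5 then 33
  else if d t == 2 then demand2 x t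
  else if (d x == 4) && (d t == 3) then demand3 t else 0.

Lemma nb_seq_third y x z : x \in N y -> z \in N y -> x != z -> d y = 3 ->
  exists t, nb_seq y [:: x; z; t].
Proof.
move=> xN zN xz; rewrite /dg (cardsD1 x) (cardsD1 z (_ :\ x)) !in_setD1 xN zN.
rewrite [z == x]eq_sym xz /= => -[/eqP/cards1P[t Nt]]; exists t.
have tE w : (w \in N y :\ x :\ z) = (w == t) by rewrite Nt inE.
split=> [|w].
  rewrite /= !inE negb_or xz andbT /=; have := tE t; rewrite eqxx !in_setD1.
  by case/and3P=> tz tx _; rewrite ![_ == t]eq_sym tx tz.
have [->|wx] := eqVneq w x; first by rewrite xN mem_head.
have [->|wz] := eqVneq w z; first by rewrite zN !inE eqxx orbT.
by rewrite in_cons (negbTE wx) in_cons (negbTE wz) mem_seq1 -tE !in_setD1 wx wz.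
Qed.

Lemma other_dg2 v a b : nb_seq v [:: a; b] -> v \in S -> other_dg a v = d b.
Proof.
move=> Nv vS; have [|aS va] := nb_seqE Nv (_ : a \in _); first by rewrite mem_head.
have := @other_dgE a v aS vS; rewrite e_sym va => /(_ isT).
by rewrite (nb_seq_sum _ Nv) !big_cons big_nil addn0 => /addnI.
Qed.

(** The fixed payments are tight: [(75 - 40) * 6 = (75 - 33) * 5 = 210]. Degrees 2, 3 and 4 start
    with charges -60, 15 and 90. *)
Lemma discharge v : v \in S ->
  210 + \sum_(t in N v) gift v t <= 75 * d v + \sum_(t in N v) gift t v.
Proof.
move=> vS; have dv2 := dg_ge2 vS.
have [dv6|dv6] := leqP 6 (d v).
  rewrite (eq_bigr (fun=> 40)) => [|t _]; last by rewrite /gift dv6.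
  by rewrite sum_nat_const -/(d v); lia.
have [dv5|dv5] := eqVneq (d v) 5.
  rewrite (eq_bigr (fun=> 33)) => [|t _]; last by rewrite /gift dv5.
  by rewrite sum_nat_const -/(d v); lia.
have giftE t : gift v t = if d t == 2 then demand2 v t
    else if (d v == 4) && (d t == 3) then demand3 t else 0.
  by rewrite /gift leqNgt dv6 (negbTE dv5).
have dem30 x t : demand2 x t <= 30 by rewrite /demand2; case: ifP => // _; case: ifP.
have dem8 t : demand3 t <= 8 by rewrite /demand3; case: ifP => // _; case: ifP => // _; case: ifP.
have gift_ge5 x t : 5 <= d x -> 33 <= gift x t.
  by rewrite /gift leq_eqVlt eq_sym; case: ifP => // _; rewrite orbF => ->.
(* [s1] lists the neighbours of degree 2; the cases below are on its length. *)
have [s1 [s2 [Nv a1 a2 sz]]] := nb_seq_exists (fun t => d t == 2) v.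
rewrite !(nb_seq_sum _ Nv).
have dcase : [|| d v == 2, d v == 3 | d v == 4] by nat_lia.
case/or3P: dcase => /eqP dv; rewrite dv in sz *.
- have s10 : s1 = [::].
    case: s1 a1 Nv sz => // a s1 /= /andP[/eqP da _] Nv _.
    have [|aS va] := nb_seqE Nv (_ : a \in _); first by rewrite mem_head.
    by case: (no_adjacent_2vertices vS aS va dv da).
  subst s1; case: s2 Nv a2 sz => [|a [|b []]] //= Nv /and3P[da db _] _.
  have [aS va] := nb_seqE Nv (mem_head _ _).
  have [bS vb] : b \in S /\ e v b by apply: (nb_seqE Nv); rewrite !inE eqxx orbT.
  have Nv' : nb_seq v [:: b; a] by apply: nb_seq_perm Nv; rewrite (perm_catC [:: a] [:: b]).
  have ga : gift a v = if 6 <= d a then 40 else if d a == 5 then 33 else demand2 a v.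
    by rewrite /gift dv.
  have gb : gift b v = if 6 <= d b then 40 else if d b == 5 then 33 else demand2 b v.
    by rewrite /gift dv.
  rewrite !big_cons !big_nil !giftE dv (negbTE da) (negbTE db) /= ga gb.
  rewrite /demand2 (other_dg2 Nv) // (other_dg2 Nv') //.
  have := dg_ge2 aS; have := dg_ge2 bS.
  by do ?(case: ifP => ?); nat_lia.
- have s1x : size s1 <= 3 by nat_lia.
  case: s1 a1 Nv sz s1x => [|a s1].
    case: s2 a2 => [|x [|y [|z []]]] //= /and4P[dx dy dz _] Nv _ _.
    by rewrite !big_cons !big_nil !giftE dv (negbTE dx) (negbTE dy) (negbTE dz) /=; nat_lia.
  case: s1 => [|b s1].
    case: s2 a2 => [|x [|y []]] //= /and3P[dx dy _] /andP[/eqP da _] Nv _ _.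
    have [_ [aS xS yS] [va vx vy] _] := nb_seq3 Nv.
    have [d7 d8] := vertex3_1 vS Nv da.
    rewrite !big_cons !big_nil !giftE dv da (negbTE dx) (negbTE dy) /= !addn0.
    have := dem30 v a.
    have [x5|x5] := leqP 5 (d x); first by have := gift_ge5 x v x5; nat_lia.
    have [y5|y5] := leqP 5 (d y); first by have := gift_ge5 y v y5; nat_lia.
    have no5 : [exists w in N v, 5 <= d w] = false.
      apply/existsP => -[w /andP[]]; case: Nv => _ ->; rewrite !inE.
      by case/or3P=> /eqP->; nat_lia.
    have gx w : d w <= 4 -> gift w v = if d w == 4 then demand3 v else 0.
      by move=> w4; rewrite /gift dv /= andbT; do ?(case: ifP => ?); nat_lia.
    rewrite (gx x) // (gx y) // /demand3 no5.
    have [wB|wB] := leqP 6 (other_dg v a).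
      rewrite /demand2 wB (_ : [exists z in N v, d z == 2] = true); last first.
        by apply/existsP; exists a; rewrite da inE aS va.
      by do ?(case: ifP => ?); nat_lia.
    rewrite (_ : [exists z in N v, (d z == 2) && (other_dg v z <= 5)] = true); last first.
      by apply/existsP; exists a; rewrite da inE aS va.
    by have := d8 wB; do ?(case: ifP => ?); nat_lia.
  case: s1 => [|c s1].
    case: s2 a2 => [|x []] //= /andP[dx _] /and3P[/eqP da /eqP db _] Nv _ _.
    (* [a] and [b] ask only 20 each, and [x] pays at least 33: [40 <= 15 + 33]. *)
    have [oa x5] := vertex3_11 vS Nv da db.
    have Nv' : nb_seq v [:: b; a; x].
      by apply: nb_seq_perm Nv; apply/permP => p /=; nat_lia.
    have [ob _] := vertex3_11 vS Nv' db da.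
    rewrite !big_cons !big_nil !giftE dv da db (negbTE dx) /= /demand2 oa ob.
    by have := gift_ge5 x v x5; nat_lia.
  case: s1 s2 {a2} => [|? ?] [|? ?] //= /and4P[/eqP da /eqP db /eqP dc _] Nv _ _.
  by case: (no_3vertex_111 vS Nv da db dc).
(* A 2-neighbour asks at most 30 and any other neighbour at most 8, so up to two 2-neighbours cost
   at most [76 <= 90]. *)
- have s1x : size s1 <= 4 by nat_lia.
  have gle t : d t != 2 -> gift v t <= 8.
    by move=> dt; rewrite giftE (negbTE dt); case: ifP.
  have gle2 t : d t == 2 -> gift v t = demand2 v t by rewrite giftE => ->.
  case: s1 a1 Nv sz s1x => [|a s1].
    case: s2 a2 => [|x [|y [|z [|t []]]]] //= /and5P[/gle dx /gle dy /gle dz /gle dt _] Nv _ _.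
    by rewrite !big_cons !big_nil; nat_lia.
  case: s1 => [|b s1].
    case: s2 a2 => [|x [|y [|z []]]] //= /and4P[/gle dx /gle dy /gle dz _] /andP[da _] Nv _ _.
    by rewrite !big_cons !big_nil gle2 //; have := dem30 v a; nat_lia.
  case: s1 => [|c s1].
    case: s2 a2 => [|x [|y []]] //= /and3P[/gle dx /gle dy _] /and3P[da db _] Nv _ _.
    rewrite !big_cons !big_nil (gle2 a) // (gle2 b) //.
    by have := dem30 v a; have := dem30 v b; nat_lia.
  case: s1 => [|f s1].
    case: s2 a2 => [|y []] //= /andP[dy _] /and4P[da db dc _] Nv _ _.
    rewrite !big_cons !big_nil (gle2 a) // (gle2 b) // (gle2 c) //.
    have := gle _ dy; have := dem30 v a; have := dem30 v b; have := dem30 v c.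
    (* One request of 20 is enough: [20 + 30 + 30 + 8 <= 90]. *)
    have [oa|oa] := leqP 6 (other_dg v a); first by rewrite {3 4}/demand2 oa; nat_lia.
    have [ob|ob] := leqP 6 (other_dg v b); first by rewrite {2 5}/demand2 ob; nat_lia.
    have [oc|oc] := leqP 6 (other_dg v c); first by rewrite {1 6}/demand2 oc; nat_lia.
    have [->|gy] := eqVneq (gift v y) 0; first by nat_lia.
    have yS : y \in S by have [_ []] := nb_seq4 Nv.
    have vy : e v y by have [_ _ []] := nb_seq4 Nv.
    have dy3 : d y = 3.
      by move: gy; rewrite giftE (negbTE dy) dv /=; case: (d y =P 3) => //= _; rewrite eqxx.
    have gyE : gift v y = demand3 y by rewrite giftE (negbTE dy) dv dy3.
    have no5 : [exists w in N y, 5 <= d w] = false.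
      by move: gy; rewrite gyE /demand3; case: ifP.
    (* A gift to [y] now presupposes a 2-vertex [z] next to [y]; then [y] asks 5 and [a], [b], [c]
       ask 27 each: [81 + 5 <= 90]. *)
    have key z : z \in N y -> d z = 2 -> [/\ 6 <= other_dg y z,
        other_dg v a = 5, other_dg v b = 5 & other_dg v c = 5].
      move=> zN dz; have vN : v \in N y by rewrite inE vS e_sym.
      have vz : v != z by apply: contra_eq_neq dz => <-; rewrite dv.
      have [t Ny] := nb_seq_third vN zN vz dy3.
      have dt : d t <= 4.
        have tN : t \in N y by case: Ny => _ ->; rewrite !inE eqxx !orbT.
        by have /existsPn/(_ t) := negbT no5; rewrite tN -ltnNge.
      have Nb : nb_seq v [:: b; a; c; y] by apply: nb_seq_perm Nv; apply/permP => p /=; nat_lia.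
      have Nc : nb_seq v [:: c; a; b; y] by apply: nb_seq_perm Nv; apply/permP => p /=; nat_lia.
      have := vertex4_111 vS Nv Ny (eqP da) (eqP db) (eqP dc) dz dt oa ob oc.
      have := vertex4_111 vS Nb Ny (eqP db) (eqP da) (eqP dc) dz dt ob oa oc.
      have := vertex4_111 vS Nc Ny (eqP dc) (eqP da) (eqP db) dz dt oc oa ob.
      by case=> _ -> [_ ->] [-> ->].
    have no8 : [exists z in N y, (d z == 2) && (other_dg y z <= 5)] = false.
      apply/existsP => -[z /and3P[zN /eqP dz oz]].
      by have [] := key z zN dz; nat_lia.
    move: gy; rewrite gyE /demand3 no5 no8; case: existsP => // -[z /andP[zN /eqP dz]] _.
    by have [_ oa5 ob5 oc5] := key z zN dz; rewrite /demand2 oa5 ob5 oc5 /=; nat_lia.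
  case: s1 s2 {a2} => [|? ?] [|? ?] //= /and5P[/eqP da /eqP db /eqP dc /eqP df _] Nv _ _.
  have Nb : nb_seq v [:: b; a; c; f] by apply: nb_seq_perm Nv; apply/permP => p /=; nat_lia.
  have Nc : nb_seq v [:: c; a; b; f] by apply: nb_seq_perm Nv; apply/permP => p /=; nat_lia.
  have Nf : nb_seq v [:: f; a; b; c] by apply: nb_seq_perm Nv; apply/permP => p /=; nat_lia.
  rewrite !big_cons !big_nil !gle2 ?da ?db ?dc ?df // /demand2.
  rewrite (vertex4_1111 vS Nv) // (vertex4_1111 vS Nb) // (vertex4_1111 vS Nc) //.
  by rewrite (vertex4_1111 vS Nf) //; nat_lia.
Qed.

(** Gifts sent and received cancel in the total; the rest is divided by 15. *)
Lemma not_sparse : 14 * #|S| <= 5 * \sum_(v in S) d v.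
Proof.
have : \sum_(v in S) (210 + \sum_(t in N v) gift v t) <=
    \sum_(v in S) (75 * d v + \sum_(t in N v) gift t v).
  by apply: leq_sum => v; apply: discharge.
rewrite big_split [X in _ <= X]big_split sum_nat_const.
have -> : \sum_(v in S) 75 * d v = 75 * \sum_(v in S) d v by rewrite big_distrr.
rewrite (exchange_big_dep (mem S)) /= => [|v t _]; last by rewrite inE => /andP[].
rewrite [X in _ <= _ + X](eq_bigr (fun v => \sum_(t in S | v \in N t) gift t v)).
  by nat_lia.
move=> v vS; apply: eq_bigl => t.
by rewrite !inE vS [e v t]e_sym.
Qed.

End Reducible.

(** * Face-spanned graphs and minors *)

Section Chains.
Import GRing.Theory.
Local Open Scope ring_scope.

Lemma addFF2 (a : 'F_2) : a + a = 0.
Proof. by apply/val_inj; case: a => -[|[|[]]]. Qed.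

Lemma addF2_eq0 (a b : 'F_2) : a + b = 0 -> a = b.
Proof. by move=> ab; apply: (addIr b); rewrite ab addFF2. Qed.

(** An element of the cycle space over F_2: the indicator of an edge set with all degrees even. *)
Definition even_chain (T : finType) (e : rel T) (z : T -> T -> 'F_2) : Prop :=
  [/\ forall x y, z x y = z y x, forall x y, ~~ e x y -> z x y = 0 &
      forall x, \sum_y z x y = 0].

(* [l x y] is the face on the left of the dart [x -> y]; the two clauses say
   that the face boundaries are cycles, and that they span the cycle space. *)
Definition face_spanned (T : finType) (e : rel T) : Prop :=
  exists (Q : finType) (l : T -> T -> Q),
    (forall c x, \sum_(y | e x y) (c (l x y) + c (l y x)) = 0 :> 'F_2) /\
    forall z, even_chain e z ->
      exists c : Q -> 'F_2, forall x y, e x y -> z x y = c (l x y) + c (l y x).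

(** Deleting an edge merges the faces on its two sides. An even chain of [e'] vanishes on the
    deleted edges, so its face function is constant on the merged classes. *)
Lemma face_spanned_del (T : finType) (e e' : rel T) :
    symmetric e -> symmetric e' -> subrel e' e ->
  face_spanned e -> face_spanned e'.
Proof.
move=> e_sym e'_sym ee' [Q [l [lB lZ]]].
pose m q q' := [exists x, [exists y,
  [&& e x y, ~~ e' x y, l x y == q & l y x == q']]].
have m_csym : connect_sym m.
  apply: sym_connect_sym => q q'; apply/existsP/existsP => -[x /existsP[y]] /and4P[xy xy' a b];
    by exists y; apply/existsP; exists x; rewrite e_sym xy e'_sym xy' a b.
have mP x y : e x y -> ~~ e' x y -> m (l x y) (l y x).
  by move=> xy xy'; apply/existsP; exists x; apply/existsP; exists y; rewrite xy xy' !eqxx.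
exists Q, (fun x y => fingraph.root m (l x y)); split=> [c x|z [zC z0 zE]].
  rewrite -[RHS](lB (fun q => c (fingraph.root m q)) x) [RHS](bigID (e' x)) /= [X in _ = _ + X]big1.
    by rewrite addr0; apply: eq_bigl => y; case xy: (e' x y); rewrite ?andbF // ee'.
  move=> y /andP[xy xy']; rewrite (fingraph.rootP m_csym (connect1 (mP _ _ xy xy'))).
  exact: addFF2.
have [|c cP] := lZ z.
  by split=> // x y xy; apply: z0; apply: contraNN xy; apply: ee'.
exists c => x y xy; rewrite (cP _ _ (ee' _ _ xy)).
suff cr q : c q = c (fingraph.root m q) by congr (_ + _).
have /connectP[p + ->] := connect_root m q.
elim: p q => //= q' p IH q /andP[/existsP[u /existsP[v]] /and4P[uv uv' /eqP<- /eqP vu] pth].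
rewrite -(IH _ pth) -vu; apply: addF2_eq0; rewrite -cP //; exact: z0.
Qed.

Lemma sum_symm_eq0 (T : Type) (s : seq T) (F : T -> T -> 'F_2) :
    (forall x y, F x y = F y x) -> (forall x, F x x = 0) ->
  \sum_(x <- s) \sum_(y <- s) F x y = 0.
Proof.
move=> FC F0; elim: s => [|a s IH]; first by rewrite big_nil.
rewrite !big_cons F0 add0r.
under [X in _ + X]eq_bigr => x _ do rewrite big_cons.
rewrite big_split /= IH addr0 [X in _ + X](eq_bigr (F a)) => [|x _]; last exact: FC.
exact: addFF2.
Qed.

(** * Contraction of connected fibres *)

Section Contraction.
Variables (P T : finType) (eP : rel P) (eT : rel T) (r : P -> option T).
Variable dart : T -> T -> P * P.
Hypotheses (eP_sym : symmetric eP) (eP_irr : irreflexive eP).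
Hypotheses (eT_sym : symmetric eT) (eT_irr : irreflexive eT).
Definition inner p q := [&& eP p q, r p == r q & r p].
Hypothesis r_conn : forall p q, r p -> r p = r q -> connect inner p q.
Hypothesis dartP : forall u v, eT u v ->
  [/\ eP (dart u v).1 (dart u v).2, r (dart u v).1 = Some u &
      r (dart u v).2 = Some v].
Hypothesis dartC : forall u v, eT u v -> dart v u = ((dart u v).2, (dart u v).1).
Hypothesis dart_surj : forall p q, eP p q -> r p != r q ->
  exists u v, eT u v /\ dart u v = (p, q).

(** By [dartP] and [dart_surj], the darts of the edges at [u] are exactly the edges of [eP] leaving
    the fibre over [u]. *)
Lemma sum_dart u (F : P -> P -> 'F_2) :
  \sum_(v | eT u v) F (dart u v).1 (dart u v).2 =
  \sum_(p | r p == Some u) \sum_(q | eP p q && (r q != Some u)) F p q.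
Proof.
rewrite pair_big_dep /=.
have -> : \sum_(v | eT u v) F (dart u v).1 (dart u v).2 =
    \sum_(v in [set v | eT u v]) F (dart u v).1 (dart u v).2.
  by apply: eq_bigl => v; rewrite inE.
rewrite -(big_imset (fun pq => F pq.1 pq.2)) /=; last first.
  move=> v v'; rewrite !inE => uv uv' E.
  have [_ _ rv] := dartP uv; have [_ _] := dartP uv'.
  by rewrite -E rv => -[].
apply: eq_bigl => -[p q] /=; apply/imsetP/and3P.
  case=> v; rewrite inE => uv E; have [] := dartP uv; rewrite -E /= => pq -> ->.
  split=> //; apply: contraTneq uv => -[->]; by rewrite eT_irr.
case=> rp pq rq; have [|u' [v [uv E]]] := dart_surj pq.
  by rewrite (eqP rp) eq_sym.
have [_ ru _] := dartP uv; exists v; rewrite ?inE.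
all: by move: rp; rewrite -[p]/((p, q).1) -E ru => /eqP[<-].
Qed.

(** The edges of a walk, counted modulo 2, have its two ends as boundary. *)
Lemma path_chain p q : connect inner p q -> exists w : P -> P -> 'F_2,
  [/\ forall x y, w x y = w y x, forall x y, ~~ inner x y -> w x y = 0 &
      forall x, \sum_y w x y = (x == p)%:R + (x == q)%:R].
Proof.
have inner_sym : symmetric inner.
  move=> x y; rewrite /inner eP_sym [r y == r x]eq_sym.
  by case: eqP => [->|]; rewrite ?andbF.
case/connectP => s + ->; elim: s p => [|a s IH] p /=.
  by move=> _; exists (fun _ _ => 0); split=> // x; rewrite big1 // addFF2.
case/andP=> pa /IH[w [wC w0 wB]].
have neq : p != a by apply: contraTneq pa => ->; rewrite /inner eP_irr.
pose b x y : 'F_2 := ((x == p) && (y == a))%:R + ((x == a) && (y == p))%:R.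
exists (fun x y => w x y + b x y); split=> [x y|x y xy|x].
- by rewrite wC /b addrC [RHS]addrC; congr (_ + _); rewrite addrC ![(y == _) && _]andbC.
- rewrite w0 // /b add0r.
  have -> : (x == p) && (y == a) = false.
    by apply: contraNF xy => /andP[/eqP-> /eqP->].
  have -> : (x == a) && (y == p) = false.
    by apply: contraNF xy => /andP[/eqP-> /eqP->]; rewrite inner_sym.
  by rewrite addr0.
- rewrite big_split /= wB /b big_split /=.
  have one t c : \sum_y ((x == t) && (y == c))%:R = (x == t)%:R :> 'F_2.
    case: (x == t); last by rewrite big1.
    by rewrite (bigD1 c) //= eqxx big1 ?addr0 // => y /negbTE->.
  rewrite !one; set A := (x == a)%:R; set B := (x == p)%:R.
  by rewrite addrC addrACA [B + A]addrC addrACA addFF2 add0r addrC.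
Qed.

(** The faces of [eP] are kept and read along the darts. The relation at [u] is the sum of those
    over its fibre, where inner edges occur twice and cancel. *)
Lemma face_spanned_contract : face_spanned eP -> face_spanned eT.
Proof.
move=> [Q [l [lB lZ]]]; exists Q, (fun u v => l (dart u v).1 (dart u v).2); split.
  move=> c u; pose D p q : 'F_2 := c (l p q) + c (l q p).
  rewrite (eq_bigr (fun v => D (dart u v).1 (dart u v).2)); last first.
    by move=> v uv; rewrite (dartC uv).
  rewrite sum_dart.
  pose B := [pred p | r p == Some u].
  have : \sum_(p | B p) \sum_(q | eP p q) D p q = 0 by rewrite big1 // => p _; apply: lB.
  rewrite (eq_bigr (fun p => \sum_(q | eP p q && (r q == Some u)) D p q +
      \sum_(q | eP p q && (r q != Some u)) D p q)) => [|p _]; last exact: bigID.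
  rewrite big_split /= [X in X + _](_ : _ = 0) ?add0r //.
  pose F p q := if [&& B p, B q & eP p q] then D p q else 0.
  rewrite -[RHS](@sum_symm_eq0 P (index_enum P) F); first last.
  - by move=> p; rewrite /F eP_irr !andbF.
  - move=> p q; rewrite /F eP_sym /D [c _ + _]addrC; congr (if _ then _ else _).
    by rewrite andbCA.
  rewrite [LHS]big_mkcond; apply: eq_bigr => p _; rewrite /F -[r p == _]/(B p); case: (B p) => /=.
    by rewrite [LHS]big_mkcond; apply: eq_bigr => q _; rewrite andbC.
  by rewrite big1.
move=> z [zC z0 zE].
(* [z] is lifted to the darts; evenness is then restored in each fibre by
   paths to a representative vertex. *)
pose zz p q : 'F_2 := if (r p, r q) is (Some u, Some v) then
  (if (u != v) && eP p q then z u v else 0) else 0.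
have zzC p q : zz p q = zz q p.
  rewrite /zz; case: (r p) (r q) => [u|] [v|] //.
  by rewrite eP_sym eq_sym zC.
have zz_dart u v : eT u v -> zz (dart u v).1 (dart u v).2 = z u v.
  move=> uv; have [pq ru rv] := dartP uv; rewrite /zz ru rv pq andbT.
  by case: eqP => // E; rewrite E eT_irr in uv.
(* [t] is the boundary of the lift. It sums to 0 over each fibre, so moving it to the
   representatives annihilates it. *)
pose t p := \sum_q zz p q.
pose rep p := odflt p [pick q | (r q == r p) && r p].
have repE p : r (rep p) = r p by rewrite /rep; case: pickP => //= q /andP[/eqP].
have rep_eq p q : r p -> r p = r q -> rep p = rep q.
  move=> rp E; rewrite /rep -E; case: pickP => //= /(_ p); by rewrite eqxx rp.
have tB u : \sum_(p | r p == Some u) t p = 0.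
  rewrite -[RHS](zE u) [RHS](bigID (eT u)) /= [X in _ = _ + X]big1 => [|v]; last exact: z0.
  rewrite addr0 -[RHS](eq_bigr _ (fun v uv => zz_dart u v uv)) sum_dart.
  apply: eq_bigr => p /eqP rp; rewrite /t [LHS](bigID (fun q => eP p q && (r q != Some u))) /=.
  rewrite [X in _ + X]big1 ?addr0 // => q; rewrite negb_and negbK /zz rp.
  case: (r q) => // v /orP[/negbTE->|/eqP[->]]; by rewrite ?andbF ?eqxx.
have tN p : r p = None -> t p = 0.
  by move=> rp; rewrite /t big1 // => q _; rewrite /zz rp.
have trep x : \sum_(p | rep p == x) t p = 0.
  case E : (r x) => [u|].
    have [rx|rx] := eqVneq (rep x) x.
      rewrite -[RHS](tB u); apply: eq_bigl => p; apply/eqP/eqP => [px|rp].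
        by rewrite -repE px.
      by rewrite -rx; apply: rep_eq; rewrite rp.
    rewrite big1 // => p /eqP px; case/eqP: rx; rewrite -{2}px.
    by apply: rep_eq; [rewrite E|rewrite -px repE].
  rewrite big1 // => p /eqP px; apply: tN; by rewrite -repE px.
have wP p : exists w : P -> P -> 'F_2,
  [/\ forall x y, w x y = w y x, forall x y, ~~ inner x y -> w x y = 0 &
      forall x, \sum_y w x y = (x == p)%:R + (x == rep p)%:R].
  apply: path_chain; case rp : (r p) => [u|].
    by apply: r_conn; rewrite ?rp // repE.
  by rewrite /rep; case: pickP => [q|_] /=; rewrite ?rp ?andbF // connect0.
have [w wP'] := fin_all_exists wP.
pose z' x y := zz x y + \sum_p t p * w p x y.
have [|c cP] := lZ z'.
  split=> [x y|x y xy|x].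
  - by rewrite /z' zzC; congr (_ + _); apply: eq_bigr => p _; have [-> _ _] := wP' p.
  - rewrite /z' [zz _ _](_ : _ = 0) ?add0r; last first.
      by rewrite /zz (negbTE xy); case: (r x) (r y) => [u|] [v|]; rewrite ?andbF.
    rewrite big1 // => p _; have [_ w0 _] := wP' p.
    by rewrite w0 ?mulr0 // /inner (negbTE xy).
  - rewrite big_split /= -/(t x) exchange_big /=.
    rewrite (eq_bigr (fun p => (x == p)%:R * t p + (rep p == x)%:R * t p)); last first.
      move=> p _; rewrite -big_distrr /=; have [_ _ ->] := wP' p.
      by rewrite mulrDr ![t p * _]mulrC [x == rep p]eq_sym.
    rewrite big_split /= -[RHS](trep x) [RHS]big_mkcond.
    have -> : \sum_p (x == p)%:R * t p = t x.
      rewrite (bigD1 x) //= eqxx mul1r big1 ?addr0 // => p.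
      by rewrite eq_sym => /negbTE->; rewrite mul0r.
    rewrite addrA addFF2 add0r; apply: eq_bigr => p _.
    by case: (rep p == x); rewrite ?mul1r ?mul0r.
(* The correcting walks use inner edges only, so [z'] still agrees with [z] on the darts. *)
exists c => u v uv; have [pq ru rv] := dartP uv.
rewrite (dartC uv) -(cP _ _ pq) /z' zz_dart // big1 ?addr0 // => p _.
have [_ w0 _] := wP' p; rewrite w0 ?mulr0 // /inner ru rv.
by rewrite (_ : _ == _ = false) ?andbF //; apply/eqP => -[E]; rewrite E eT_irr in uv.
Qed.

End Contraction.
End Chains.

(** * Euler's bound *)

(** A path is prolonged at its head [x] by a neighbour other than its second vertex. By finiteness
    it meets itself, at distance at least 2 from [x], which closes a cycle. *)
Lemma exists_ucycle (T : finType) (e : rel T) (x0 y0 : T) :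
    symmetric e -> irreflexive e ->
    (forall x y, e x y -> exists2 y', e x y' & y' != y) -> e x0 y0 ->
  exists c : seq T, ucycle e c /\ 2 < size c.
Proof.
move=> e_sym e_irr two xy0.
suff H n x y p : #|T| <= n + size p -> path e x (y :: p) -> uniq [:: x, y & p] ->
    exists c : seq T, ucycle e c /\ 2 < size c.
  apply: (H #|T| x0 y0 [::]); rewrite ?addn0 //= ?xy0 // inE andbT.
  by apply: contraTneq xy0 => ->; rewrite e_irr.
elim: n x y p => [|n IH] x y p.
  move=> le_p _ us; have := max_card [in [:: x, y & p]].
  by rewrite (card_uniqP us) /= => /leq_trans/(_ le_p); rewrite add0n ltnNge leqnSn.
move=> le_p pth us; have xy : e x y by case/andP: pth.
have [y' xy' y'y] := two _ _ xy.
have y'x : y' != x by apply: contraTneq xy' => ->; rewrite e_irr.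
have [y'p|y'p] := boolP (y' \in p); last first.
  apply: (IH y' x (y :: p)); first by rewrite /= addnS -addSn.
    by rewrite /= e_sym xy'.
  by rewrite cons_uniq us andbT !inE !negb_or y'x y'y.
case/splitPr: y'p pth us => p1 p2 pth us.
exists [:: x, y & rcons p1 y']; split; last by rewrite /= size_rcons.
move: pth us; rewrite -cat_rcons /ucycle -!cat_cons cat_path cat_uniq => /andP[pth _].
case/and3P=> us _ _; rewrite us andbT /= in pth *.
by case/andP: pth => -> pth; rewrite rcons_path pth last_rcons e_sym xy'.
Qed.

Section Darts.
Variables (T : finType).
Implicit Types (x y : T) (R : rel T).

Definition darts R : {set T * T} := [set p | R p.1 p.2].
Definition upper R : {set T * T} :=
  [set p | R p.1 p.2 && (enum_rank p.1 < enum_rank p.2)].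

Lemma card_darts R : #|darts R| = \sum_x #|[pred y | R x y]|.
Proof.
rewrite -sum1_card (eq_bigl (fun p => true && R p.1 p.2)) => [|p]; last by rewrite inE.
by rewrite -(pair_big_dep xpredT R (fun _ _ => 1)) /=; apply: eq_bigr => x _; rewrite sum1_card.
Qed.

Lemma card_darts_upper R : symmetric R -> irreflexive R ->
  #|darts R| = 2 * #|upper R|.
Proof.
move=> R_sym R_irr; pose sw (p : T * T) := (p.2, p.1).
have swK : cancel sw sw by case.
have -> : darts R = upper R :|: sw @: upper R.
  apply/finset.setP=> -[x y]; rewrite !inE /=; apply/idP/orP.
    move=> xy; case: (ltngtP (enum_rank x) (enum_rank y)) => [lt|gt|eq].
    - by left; rewrite xy.
    - by right; apply/imsetP; exists (y, x); rewrite // inE /= R_sym xy.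
    - by move: xy; rewrite (enum_rank_inj (val_inj eq)) R_irr.
  by case=> [/andP[]//|/imsetP[[a b]]]; rewrite inE /= => /andP[ab _] [-> ->]; rewrite R_sym.
rewrite cardsU card_imset; last exact: can_inj swK.
rewrite (_ : _ :&: _ = finset.set0) ?cards0 ?subn0 ?mul2n ?addnn //.
apply/finset.setP=> -[x y]; rewrite !inE /=; apply/negP => /andP[/andP[_ lt]].
case/imsetP=> [[a b]]; rewrite inE /= => /andP[_ lt'] [xb ya].
by move: lt; rewrite xb ya ltnNge ltnW.
Qed.

End Darts.

Section EvenGirth.
Import GRing.Theory.
Local Open Scope ring_scope.

(** The support has no vertex of degree 1, so it contains a cycle; each of the at least [g] vertices
    of this cycle is the origin of two darts. *)
Lemma even_chain_girth (T : finType) (e : rel T) (g : nat) z :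
    symmetric e -> irreflexive e ->
    (forall c : seq T, (2 < size c)%N -> ucycle e c -> (g <= size c)%N) ->
    even_chain e z -> (exists x y, z x y != 0) ->
  (2 * g <= #|darts (fun x y => z x y != 0%R)|)%N.
Proof.
move=> e_sym e_irr girth_e [zC z0 zE] [x0 [y0 z00]].
pose R := [rel x y | z x y != 0].
have R_sym : symmetric R by move=> x y; rewrite /R /= zC.
have Re : subrel R e.
  by move=> x y /=; apply: contraNT => /z0->.
have R_irr : irreflexive R.
  by move=> x; apply: contraFF (e_irr x); apply: Re.
have two x y : R x y -> exists2 y', R x y' & y' != y.
  move=> xy; apply/exists_inP; apply: contraNT xy => /exists_inPn none.
  move: (zE x); rewrite (bigD1 y) //= big1 ?addr0 => [->|y' y'y]; first by rewrite eqxx.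
  by apply/eqP; apply: contraTT y'y => /none.
have [c [/andP[cR cu] c2]] := exists_ucycle R_sym R_irr two z00.
have ce : ucycle e c by rewrite /ucycle cu andbT; exact: sub_cycle cR.
have deg2 x : x \in c -> (2 <= #|[pred y | R x y]|)%N.
  move=> xc; have xy : R x (next c x) := next_cycle cR xc.
  have [y' xy' y'y] := two _ _ xy.
  rewrite (cardD1 (next c x)) inE xy (cardD1 y') !inE /= y'y.
  by rewrite -[_ != 0]/(R x y') xy'.
rewrite card_darts.
apply: (@leq_trans (\sum_(x in c) 2)%N).
  rewrite sum_nat_const (card_uniqP cu) mulnC leq_mul2r /=.
  exact: girth_e.
rewrite big_mkcond; apply: leq_sum => x _; case: ifP => // xc; exact: deg2.
Qed.

End EvenGirth.

Section EulerBound.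
Import GRing.Theory.
Local Open Scope ring_scope.
Variables (T : finType) (e : rel T) (g : nat).
Hypotheses (e_sym : symmetric e) (e_irr : irreflexive e).
Hypothesis e_faces : face_spanned e.
Hypothesis e_girth : forall z, even_chain e z -> (exists x y, z x y != 0) ->
  (2 * g <= #|darts (fun x y => z x y != 0%R)|)%N.

Let E := upper e.
Let m := #|E|.
Let n := #|T|.
Let src (i : 'I_m) : T := (enum_val i).1.
Let tgt (i : 'I_m) : T := (enum_val i).2.

Let srctgt i : e (src i) (tgt i) /\ (enum_rank (src i) < enum_rank (tgt i))%N.
Proof. by have := enum_valP i; rewrite inE => /andP. Qed.

Definition incidence : 'M['F_2]_(m, n) :=
  \matrix_(i, j) ((src i == enum_val j)%:R + (tgt i == enum_val j)%:R).

Lemma sum_edges (f : T -> T -> 'F_2) t : (forall x y, f x y = f y x) ->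
  \sum_i f (src i) (tgt i) * ((src i == t)%:R + (tgt i == t)%:R) =
  \sum_(y | e t y) f t y.
Proof.
move=> fC; pose G (p : T * T) := f p.1 p.2 * ((p.1 == t)%:R + (p.2 == t)%:R).
transitivity (\sum_(p in E) G p); first (by rewrite (big_enum_val G) /=; reflexivity).
rewrite (eq_bigl (fun p => true && (e p.1 p.2 && (enum_rank p.1 < enum_rank p.2)%N))); last first.
  by move=> p; rewrite inE.
rewrite -(pair_big_dep xpredT (fun x y => e x y && (enum_rank x < enum_rank y)%N)
  (fun x y => G (x, y))) /=.
have part (x y : T) (b : bool) : (if b then G (x, y) else 0) =
    (if x == t then if b then f x y else 0 else 0) +
    (if y == t then if b then f x y else 0 else 0).
  rewrite /G /= mulrDr; case: b; last by rewrite !if_same addr0.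
  by case: (x == t); case: (y == t); rewrite ?mulr1 ?mulr0.
under eq_bigr => x _ do rewrite big_mkcond.
under eq_bigr => x _ do under eq_bigr => y _ do rewrite part.
pose b x y := e x y && (enum_rank x < enum_rank y)%N.
rewrite (eq_bigr (fun x => (if x == t then \sum_y (if b t y then f t y else 0) else 0) +
    (if b x t then f x t else 0))); last first.
  move=> x _; rewrite big_split /=; congr (_ + _).
    by case: eqP => [->|_] //; rewrite big1.
  by rewrite -[LHS]big_mkcond big_pred1_eq.
rewrite big_split /= -[X in X + _]big_mkcond /= big_pred1_eq /b.
rewrite -big_split /= [RHS]big_mkcond; apply: eq_bigr => y _.
rewrite [e y t]e_sym (fC y t); case yt: (e t y); last by rewrite addr0.
case: (ltngtP (enum_rank t) (enum_rank y)) => [lt|gt|eq]; rewrite ?addr0 ?add0r //.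
by move: yt; rewrite (enum_rank_inj (val_inj eq)) e_irr.
Qed.


Lemma incidence_row i : \sum_j incidence i j = 0.
Proof.
have one t : \sum_(j < n) (t == enum_val j)%:R = 1 :> 'F_2.
  rewrite (bigD1 (enum_rank t)) //= enum_rankK eqxx big1 ?addr0 // => j jt.
  by case: (t =P _) jt => // ->; rewrite enum_valK eqxx.
by under eq_bigr => j _ do rewrite mxE; rewrite big_split /= !one addFF2.
Qed.

(** Every edge has two ends, so the all-ones column is killed over F_2. *)
Lemma rank_incidence : (0 < n)%N -> (\rank incidence < n)%N.
Proof.
move=> n0; pose one : 'cV['F_2]_n := const_mx 1.
have /mulmx0_rank_max le : incidence *m one = 0.
  apply/matrixP => i j; rewrite !mxE -[RHS](incidence_row i).
  by apply: eq_bigr => k _; rewrite [one _ _]mxE mulr1.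
have : (\rank one != 0)%N.
  rewrite mxrank_eq0; apply/eqP => /matrixP/(_ (Ordinal n0) 0).
  by rewrite !mxE => /eqP; rewrite oner_eq0.
lia.
Qed.

Definition chain_of (v : 'rV['F_2]_m) x y : 'F_2 :=
  \sum_i v 0 i * (((src i == x) && (tgt i == y))%:R + ((src i == y) && (tgt i == x))%:R).

Lemma chain_of_edge v i : chain_of v (src i) (tgt i) = v 0 i.
Proof.
rewrite /chain_of (bigD1 i) //= !eqxx /= big1 => [|j ji].
  have [_ lt] := srctgt i; rewrite [src i == tgt i](_ : _ = false).
    by rewrite !addr0 mulr1.
  by apply/eqP => st; rewrite st ltnn in lt.
have [_ lti] := srctgt i; have [_ ltj] := srctgt j.
have -> : (src j == src i) && (tgt j == tgt i) = false.
  apply: contraNF ji => /andP[/eqP s /eqP t]; apply/eqP/enum_val_inj.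
  by move: s t; rewrite /src /tgt; case: (enum_val j) (enum_val i) => [? ?] [? ?] /= -> ->.
have -> : (src j == tgt i) && (tgt j == src i) = false.
  by apply/negP => /andP[/eqP s /eqP t]; move: ltj; rewrite s t ltnNge ltnW.
by rewrite addr0 mulr0.
Qed.

Lemma chain_of_even v : v *m incidence = 0 -> even_chain e (chain_of v).
Proof.
move=> v0; split=> [x y|x y xy|x].
- by apply: eq_bigr => i _; rewrite addrC.
- apply: big1 => i _; have [ei _] := srctgt i.
  have -> : (src i == x) && (tgt i == y) = false.
    by apply: contraNF xy => /andP[/eqP<- /eqP<-].
  have -> : (src i == y) && (tgt i == x) = false.
    by apply: contraNF xy => /andP[/eqP<- /eqP<-]; rewrite e_sym.
  by rewrite addr0 mulr0.
- have one t (b : bool) : \sum_(y : T) (b && (t == y))%:R = b%:R :> 'F_2.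
    rewrite (bigD1 t) //= eqxx andbT big1 ?addr0 // => y.
    by rewrite eq_sym => /negbTE->; rewrite andbF.
  rewrite /chain_of exchange_big /=.
  move/rowP: v0 => /(_ (enum_rank x)); rewrite !mxE => v0.
  rewrite -[RHS]v0; apply: eq_bigr => i _; rewrite mxE enum_rankK -big_distrr /=.
  congr (_ * _); rewrite big_split /= one.
  by under eq_bigr => y _ do rewrite andbC; rewrite one.
Qed.

Lemma card_upper_chain v : v *m incidence = 0 ->
  #|darts (fun x y => chain_of v x y != 0%R)| = (2 * #|[pred i | v 0%R i != 0%R]|)%N.
Proof.
move=> v0; have [zC z0 _] := chain_of_even v0.
rewrite card_darts_upper => [|x y|x]; first last.
- by apply/negbTE; rewrite negbK z0 // e_irr.
- by rewrite zC.
congr (2 * _)%N; rewrite -(card_imset _ enum_val_inj).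
apply: eq_card => q; rewrite inE; apply/idP/imsetP.
  move=> /andP[zq ltq]; have qE : q \in E.
    by rewrite inE ltq andbT; apply: contraNT zq => /z0->.
  exists (enum_rank_in qE q); last by rewrite enum_rankK_in.
  by rewrite inE -chain_of_edge /src /tgt enum_rankK_in.
move=> [i]; rewrite inE => vi ->.
by rewrite [X in X != 0]chain_of_edge vi; case: (srctgt i).
Qed.

Lemma row_weight (v : 'rV_m) : v *m incidence = 0 -> v != 0 ->
  (g <= #|[pred i | v 0%R i != 0%R]|)%N.
Proof.
move=> v0 /rV0Pn[i vi]; rewrite -(@leq_pmul2l 2) // -card_upper_chain //.
apply: e_girth; first exact: chain_of_even.
by exists (src i), (tgt i); rewrite chain_of_edge.
Qed.


(* A maximal independent family of face boundaries together with their sum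
   covers every edge at most twice. *)
Lemma edge_bound : (0 < n)%N -> (m < n)%N \/ (g * (m + 2) <= 2 * m + g * n)%N.
Proof.
move=> n0; have rI := rank_incidence n0; have [Q [l [lB lZ]]] := e_faces.
have [mn|mn] := ltnP m n; [by left|right].
pose lf (i : 'I_m) := l (src i) (tgt i); pose rf (i : 'I_m) := l (tgt i) (src i).
pose B : 'M['F_2]_(#|Q|, m) :=
  \matrix_(q, i) ((lf i == enum_val q)%:R + (rf i == enum_val q)%:R).
have BI : B *m incidence = 0.
  apply/matrixP => q j; rewrite !mxE.
  rewrite -[RHS](lB (fun f => (f == enum_val q)%:R) (enum_val j)).
  rewrite -(@sum_edges (fun x y => (l x y == enum_val q)%:R + (l y x == enum_val q)%:R)) => [|x y];
    last by rewrite addrC.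
  by apply: eq_bigr => i _; rewrite !mxE.
have kerB : (kermx incidence <= B)%MS.
  apply/rV_subP => v /sub_kermxP v0.
  have [c cP] := lZ _ (chain_of_even v0).
  apply/submxP; exists (\row_q c (enum_val q)); apply/rowP => i; rewrite !mxE.
  have [ei _] := srctgt i; rewrite -chain_of_edge cP //.
  have one f : \sum_(q < #|Q|) c (enum_val q) * (f == enum_val q)%:R = c f.
    rewrite (bigD1 (enum_rank f)) //= enum_rankK eqxx mulr1 big1 ?addr0 // => q qf.
    by case: (f =P _) qf => [->|]; rewrite ?enum_valK ?eqxx ?mulr0.
  rewrite (eq_bigr (fun q => c (enum_val q) * (lf i == enum_val q)%:R +
     c (enum_val q) * (rf i == enum_val q)%:R)); last by move=> q _; rewrite !mxE mulrDr.
  by rewrite big_split /= !one.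
(* The face boundaries span the cycle space, so their rank is at least [m - n + 1]. *)
have dB := mxrankS kerB; rewrite mxrank_ker in dB.
pose d := (\rank B); rewrite -/d in dB.
pose A : 'M['F_2]_(d, m) := rowsub (maxrankfun B) B.
have Afree : row_free A by exact: maxrowsub_free.
have AI : A *m incidence = 0 by rewrite mul_rowsub_mx BI; apply/matrixP => i j; rewrite !mxE.
have rowI (u : 'rV['F_2]_d) : u *m A *m incidence = 0 by rewrite -mulmxA AI mulmx0.
have rowN (u : 'rV['F_2]_d) : u != 0 -> u *m A != 0.
  by apply: contraNneq => uA; apply/eqP/(row_free_inj Afree); rewrite uA mul0mx.
have d0 : (0 < d)%N by lia.
have wA a : (g <= #|[pred i | A a i != 0%R]|)%N.
  have := row_weight (rowI (delta_mx 0 a)) (rowN (delta_mx 0 a) _).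
  rewrite -rowE (eq_card (B := [pred i | A a i != 0%R])) => [|i]; last by rewrite !inE mxE.
  apply; apply/rV0Pn; exists a; by rewrite mxE !eqxx oner_eq0.
have wS : (g <= #|[pred i | (\sum_a A a i)%R != 0%R]|)%N.
  have := row_weight (rowI (const_mx 1)) (rowN (const_mx 1) _).
  rewrite (eq_card (B := [pred i | (\sum_a A a i)%R != 0%R])) => [|i]; last first.
    by rewrite !inE mxE; congr (_ != _); apply: eq_bigr => a _; rewrite mxE mul1r.
  apply; apply/rV0Pn; exists (Ordinal d0); by rewrite mxE oner_eq0.
(* An edge bounds at most two of the chosen faces; if it bounds two, they cancel in the sum. *)
have column i : (\sum_a (A a i != 0%R) + ((\sum_a A a i)%R != 0%R) <= 2)%N.
  pose N f := (\sum_a (f == enum_val (maxrankfun B a)))%N.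
  have N1 f : (N f <= 1)%N.
    rewrite /N; case: (pickP (fun a => f == enum_val (maxrankfun B a))) => [a fa|none].
      rewrite (bigD1 a) //= big1 ?addn0 ?leq_b1 // => b ba.
      apply/eqP; rewrite eqb0; apply: contra ba => /eqP fb.
      by apply/eqP/maxrankfun_inj/enum_val_inj; rewrite -fb (eqP fa).
    by rewrite big1 // => a _; rewrite none.
  have AE a : A a i = (lf i == enum_val (maxrankfun B a))%:R +
                      (rf i == enum_val (maxrankfun B a))%:R.
    by rewrite !mxE.
  have [lr|lr] := eqVneq (lf i) (rf i).
    by rewrite !big1 => [|a _|a _]; rewrite ?AE ?lr ?addFF2 ?eqxx.
  have -> : (\sum_a (A a i != 0%R) = N (lf i) + N (rf i))%N.
    rewrite -big_split; apply: eq_bigr => a _; rewrite AE /=.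
    case: (lf i =P _) => [la|_]; case: (rf i =P _) => [ra|_] //=.
    by rewrite la ra eqxx in lr.
  have -> : \sum_a A a i = (N (lf i) + N (rf i))%:R.
    rewrite natrD !natr_sum -big_split; apply: eq_bigr => a _; exact: AE.
  move: (N1 (lf i)) (N1 (rf i)).
  by case: (N _) (N _) => [|[|?]] [|[|?]].
(* Double counting over [d + 1] rows of weight at least [g]: [g * (d + 1) <= 2 * m]. *)
have : (\sum_i (\sum_a (A a i != 0%R) + ((\sum_a A a i)%R != 0%R)) <= \sum_(i < m) 2)%N.
  by apply: leq_sum => i _.
rewrite sum_nat_const card_ord big_split exchange_big /=.
have cardE (p : pred 'I_m) : #|[pred i | p i]| = (\sum_i p i)%N.
  by rewrite -sum1_card big_mkcond /=; apply: eq_bigr => i _; rewrite inE; case: (p i).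
have : (\sum_(a < d) g <= \sum_a \sum_i (A a i != 0%R))%N.
  by apply: leq_sum => a _; rewrite -(cardE (fun i => A a i != 0)).
rewrite sum_nat_const card_ord.
move: wS; rewrite (cardE (fun i => (\sum_a A a i)%R != 0)).
have : (g * (m - n + 1) <= g * d)%N by rewrite leq_mul2l; lia.
have : (g * m = g * n + g * (m - n))%N by rewrite -mulnDr subnKC.
move: (m - n)%N (\sum_i _)%N (\sum_i _)%N => k s1 s2.
rewrite !mulnDr mulnC [(d * g)%N]mulnC; lia.
Qed.

End EulerBound.

(** * The square grid *)

Section Grid.
Import GRing.Theory.
Local Open Scope ring_scope.
Variable N' : nat.
Local Notation N := N'.+1.
Local Notation P := ('I_N * 'I_N)%type.

Definition grid_adj (p q : P) : bool :=
  [|| (q.1 == p.1.+1 :> nat) && (q.2 == p.2 :> nat),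
      (q.1 == p.1 :> nat) && (q.2 == p.2.+1 :> nat),
      (q.1.+1 == p.1 :> nat) && (q.2 == p.2 :> nat) |
      (q.1 == p.1 :> nat) && (q.2.+1 == p.2 :> nat)].

Lemma grid_adj_sym : symmetric grid_adj.
Proof. move=> [a b] [a' b']; rewrite /grid_adj /=; apply/idP/idP; lia. Qed.

Lemma grid_adj_irr : irreflexive grid_adj.
Proof. by move=> [a b]; rewrite /grid_adj /=; apply/negP; lia. Qed.

(* The square with upper right corner [(a, b)]; the squares that are not in
   the grid are merged into the outer face [(0, 0)]. *)
Definition square (a b : nat) : P :=
  if (0 < a < N)%N && (0 < b < N)%N then (inord a, inord b) else (ord0, ord0).

(** The cases are steps to the right, up, left and down, whose left sides lie above, to the left,
    below and to the right. *)
Definition left_square (p q : nat * nat) : P :=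
  if q.1 == p.1.+1 then square p.1.+1 p.2.+1
  else if q.2 == p.2.+1 then square p.1 p.2.+1
  else if q.1.+1 == p.1 then square p.1 p.2 else square p.1.+1 p.2.

Definition natp (p : P) : nat * nat := (val p.1, val p.2).

Lemma sum_grid_point (F : nat -> nat -> 'F_2) a b :
  \sum_(y : P) (if (y.1 == a :> nat) && (y.2 == b :> nat) then F y.1 y.2 else 0) =
  if (a < N)%N && (b < N)%N then F a b else 0.
Proof.
rewrite -big_mkcond; case: ifP => [/andP[aN bN]|abN].
  by rewrite (big_pred1 (Ordinal aN, Ordinal bN)) //= => -[x y].
rewrite big_pred0 // => -[x y] /=; apply: contraFF abN => /andP[/eqP<- /eqP<-].
by rewrite !ltn_ord.
Qed.

Lemma sum_grid_adj (F : nat -> nat -> 'F_2) (x : P) :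
  \sum_(y | grid_adj x y) F y.1 y.2 =
  (if (x.1.+1 < N)%N then F x.1.+1 x.2 else 0) +
  (if (x.2.+1 < N)%N then F x.1 x.2.+1 else 0) +
  (if (0 < x.1)%N then F x.1.-1 x.2 else 0) +
  (if (0 < x.2)%N then F x.1 x.2.-1 else 0).
Proof.
have [x1 x2] := (ltn_ord x.1, ltn_ord x.2).
pose G a b (y : P) := if (y.1 == a :> nat) && (y.2 == b :> nat) then F y.1 y.2 else 0.
rewrite big_mkcond (eq_bigr (fun y : P => G x.1.+1 x.2 y + G x.1 x.2.+1 y +
    (if (0 < x.1)%N then G x.1.-1 x.2 y else 0) +
    (if (0 < x.2)%N then G x.1 x.2.-1 y else 0))); last first.
  move=> y _; rewrite /G /grid_adj.
  by do ![case: ifP => ?]; rewrite ?addr0 ?add0r //; lia.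
rewrite !big_split /= !sum_grid_point x1 x2 /= !andbT.
congr (_ + _ + _ + _).
  case: ifP => x0; last by rewrite big1.
  by rewrite sum_grid_point x2 andbT (leq_ltn_trans (leq_pred _) x1).
case: ifP => x0; last by rewrite big1.
by rewrite sum_grid_point x1 (leq_ltn_trans (leq_pred _) x2).
Qed.

Lemma square_outer a b : ~~ (0 < a < N)%N || ~~ (0 < b < N)%N ->
  square a b = (ord0, ord0).
Proof. by rewrite /square -negb_and => /negbTE->. Qed.

(** Each of the four squares around [x] is met twice. A step leaving the grid would have the outer
    face on both sides, so its contribution is 0 as well. *)
Lemma grid_boundary (c : P -> 'F_2) x :
  \sum_(y | grid_adj x y) (c (left_square (natp x) (natp y)) +
                           c (left_square (natp y) (natp x))) = 0.
Proof.
pose F a b := c (left_square (natp x) (a, b)) + c (left_square (a, b) (natp x)).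
rewrite (sum_grid_adj F); case: x @F => [a b] F /=.
have [aN bN] := (ltn_ord a, ltn_ord b).
have FR : (if (a.+1 < N)%N then F a.+1 b else 0) = c (square a.+1 b.+1) + c (square a.+1 b).
  rewrite /F /left_square /= eqxx; case: ifP => aN'.
    by do ![case: ifP => ?] => //; lia.
  by rewrite !square_outer ?addFF2 //; lia.
have FU : (if (b.+1 < N)%N then F a b.+1 else 0) = c (square a b.+1) + c (square a.+1 b.+1).
  rewrite /F /left_square /= eqxx; case: ifP => aN'.
    by do ![case: ifP => ?] => //; lia.
  by rewrite !square_outer ?addFF2 //; lia.
have FL : (if (0 < a)%N then F a.-1 b else 0) = c (square a b) + c (square a b.+1).
  rewrite /F /left_square /=; case: ifP => aN'.
    by do ![case: ifP => ?]; rewrite ?prednK //; lia.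
  by rewrite !square_outer ?addFF2 //; lia.
have FD : (if (0 < b)%N then F a b.-1 else 0) = c (square a.+1 b) + c (square a b).
  rewrite /F /left_square /=; case: ifP => aN'.
    by do ![case: ifP => ?]; rewrite ?prednK //; lia.
  by rewrite !square_outer ?addFF2 //; lia.
rewrite FR FU FL FD.
move: (c (square a b)) (c (square a.+1 b)) (c (square a b.+1)) (c (square a.+1 b.+1)).
move=> p q s t; transitivity ((p + p) + (q + q) + (s + s) + (t + t)); first by ring.
by rewrite !addFF2.
Qed.

(** The face function [c a b] is the parity of the vertical edges of [z] to the left of the square
    with upper right corner [(a, b)], in its row. *)
Lemma grid_face_spanned : face_spanned grid_adj.
Proof.
exists (P : finType), (fun x y => left_square (natp x) (natp y)); split.
  exact: grid_boundary.
move=> z [zC z0 zE].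
(* The default value 0 makes [z] vanish on steps leaving the grid. *)
pose zx a b a' b' := if [&& a < N, b < N, a' < N & b' < N]%N
  then z (inord a, inord b) (inord a', inord b') else 0.
have zxE (x y : P) : z x y = zx x.1 x.2 y.1 y.2.
  by rewrite /zx !ltn_ord !inord_val; case: x y => [? ?] [].
have vertex a b : (a < N)%N -> (b < N)%N ->
    zx a b a.+1 b + zx a b a b.+1 + (if (0 < a)%N then zx a b a.-1 b else 0) +
    (if (0 < b)%N then zx a b a b.-1 else 0) = 0.
  move=> aN bN; pose x : P := (inord a, inord b).
  rewrite -[RHS](zE x) [RHS](bigID (grid_adj x)) /= [X in _ = _ + X]big1 ?addr0; last exact: z0.
  rewrite (eq_bigr (fun y : P => zx a b y.1 y.2)) => [|y _]; last by rewrite zxE !inordK.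
  rewrite (sum_grid_adj (zx a b)) /= !inordK //; congr (_ + _ + _ + _).
    by case: ifP => // aN'; rewrite /zx aN' /= !andbF.
  by case: ifP => // aN'; rewrite /zx aN' /= !andbF.
have zxC a b a' b' : zx a b a' b' = zx a' b' a b.
  by rewrite /zx zC; congr (if _ then _ else _); lia.
pose c a b := if b is b'.+1 then \sum_(k < a) zx k b' k b else 0.
have cU a b : zx a b a b.+1 = c a.+1 b.+1 + c a b.+1.
  by rewrite /c big_ord_recr /= addrAC addFF2 add0r.
have c0 b : c 0%N b = 0 by case: b => //= b; rewrite big_ord0.
have ca0 a : c a 0%N = 0 by [].
have cT a : c a N = 0.
  by rewrite /= big1 // => k _; rewrite /zx ltnn !andbF.
clearbody c.
(* Induction along the row: evenness at [(a, b)] determines the edge to the right from the other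
   three. *)
have cR a b : (a < N)%N -> (b < N)%N -> zx a b a.+1 b = c a.+1 b.+1 + c a.+1 b.
  move=> + bN; elim: a => [|a IH] aN; have := vertex _ _ aN bN; rewrite /= ?addr0.
    rewrite cU c0 addr0; case: b bN => [|b] bN /=.
      by rewrite ca0 !addr0 => /addF2_eq0.
    rewrite [zx _ b.+1 _ b]zxC cU c0 addr0 -addrA => /addF2_eq0 ->.
    by rewrite addrC.
  rewrite [zx a.+1 b a b]zxC (IH (ltnW aN)) cU.
  have -> : (if (0 < b)%N then zx a.+1 b a.+1 b.-1 else 0) = c a.+2 b + c a.+1 b.
    by case: b {IH} bN => [|b] bN /=; rewrite ?ca0 ?addr0 // zxC cU.
  rewrite -!addrA => /addF2_eq0 ->.
  move: (c a.+2 b.+1) (c a.+1 b.+1) (c a.+2 b) (c a.+1 b) => p q s t.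
  transitivity (p + s + ((q + q) + (t + t))); first by ring.
  by rewrite !addFF2 !addr0.
(* To the right of the grid [c] does not change between rows, since the horizontal edge crossed
   there is a default 0. *)
have cN b : (b < N.+1)%N -> c N b = 0.
  elim: b => [//|b IH] bN; have := cR _ b (ltnSn N') bN.
  by rewrite IH 1?ltnW // addr0 => <-; rewrite /zx ltnn !andbF.
have sqE a b : (a <= N)%N -> (b <= N)%N ->
    c (square a b).1 (square a b).2 = c a b.
  move=> aN bN; rewrite /square; case: ifP => [|/negbT]; rewrite ?negb_and.
    by move=> /andP[/andP[_ aN'] /andP[_ bN']]; rewrite /= !inordK.
  rewrite /= ca0; have [-> _|a0] := posnP a; first by rewrite c0.
  have [-> _|b0] := posnP b; first by rewrite ca0.
  move=> out; have [->|->] : a = N \/ b = N by lia.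
    by rewrite cN.
  by rewrite cT.
exists (fun q : P => c q.1 q.2) => -[a b] [a' b'] xy; rewrite zxE /=.
have := ltn_ord a; have := ltn_ord b; have := ltn_ord a'; have := ltn_ord b'.
move: xy; rewrite /grid_adj /left_square /=.
move: (nat_of_ord a) (nat_of_ord b) (nat_of_ord a') (nat_of_ord b').
move=> {b' a' b a} a b a' b' xy b'N a'N bN aN.
case/or4P: xy => /andP[/eqP E1 /eqP E2].
- by subst a' b'; do ![case: ifP => ?]; rewrite ?sqE ?cR //; lia.
- by subst a' b'; do ![case: ifP => ?]; rewrite ?sqE ?cU 1?addrC //; lia.
- by subst a b'; do ![case: ifP => ?]; rewrite ?sqE 1?zxC ?cR 1?addrC //; lia.
- by subst a' b; do ![case: ifP => ?]; rewrite ?sqE 1?zxC ?cU //; lia.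
Qed.

End Grid.

(** * Minors from overlapping connected sets *)

Section Blobs.
Variables (P T : finType) (eP : rel P) (eT : rel T).
Hypotheses (eP_sym : symmetric eP) (eP_irr : irreflexive eP).
Hypotheses (eT_sym : symmetric eT) (eT_irr : irreflexive eT).
Hypothesis eP_faces : face_spanned eP.

Definition inside (A : {set P}) p q := [&& eP p q, p \in A & q \in A].
Definition conn_in (A : {set P}) := {in A &, forall p q, connect (inside A) p q}.

(** One orientation per edge, so that each edge has a single connecting set [Y]. *)
Definition forward u v := eT u v && (enum_rank u < enum_rank v).

Variables (X : T -> {set P}) (Y : T -> T -> {set P}).
Hypothesis X_neq0 : forall u, exists p, p \in X u.
Hypothesis X_conn : forall u, conn_in (X u).
Hypothesis X_disj : forall u v, u != v -> [disjoint X u & X v].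
Hypothesis Y_conn : forall u v, forward u v -> conn_in (Y u v).
Hypothesis XY_meet : forall u v, forward u v ->
  (exists2 p, p \in X u & p \in Y u v) /\ (exists2 q, q \in X v & q \in Y u v).
Hypothesis XY_disj : forall u v w, forward u v -> w != u -> w != v ->
  [disjoint Y u v & X w].
Hypothesis Y_disj : forall u v x y, forward u v -> forward x y ->
  (u, v) != (x, y) -> [disjoint Y u v & Y x y].

Lemma connect_sub_inside (A B : {set P}) p q : A \subset B ->
  connect (inside A) p q -> connect (inside B) p q.
Proof.
move=> /fintype.subsetP AB; apply: connect_sub => x y /and3P[xy xA yA].
by apply: connect1; rewrite /inside xy !AB.
Qed.

Lemma inside_sym A : symmetric (inside A).
Proof. by move=> x y; rewrite /inside eP_sym [(y \in A) && _]andbC. Qed.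

Lemma path_inside A (B : {set P}) p s :
  path (inside A) p s -> {subset p :: s <= B} -> path (inside B) p s.
Proof.
elim: s p => //= y s IH p /andP[/and3P[py _ _] ys] sB.
rewrite /inside py !sB ?inE ?eqxx ?orbT //=; apply: IH => // x xs.
by apply: sB; rewrite inE xs orbT.
Qed.

Lemma path_inside_mem A p s x :
  path (inside A) p s -> p \in A -> x \in p :: s -> x \in A.
Proof.
elim: s p => [|y s IH] p; first by move=> _ pA; rewrite inE => /eqP->.
by case/andP=> /and3P[_ _ yA] ys pA; rewrite in_cons => /orP[/eqP->//|]; apply: IH.
Qed.

(* The beginning of a walk through [Y u v] from [X u] to [X v], up to the
   first vertex of [X v]. *)
Lemma connector u v : forward u v -> exists (W : {set P}) a b,
  [/\ W \subset Y u v :\: X v, exists2 p, p \in X u & p \in W, conn_in W,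
      a \in W & (b \in X v) && eP a b].
Proof.
move=> uv; have [[p pX pY] [q qX qY]] := XY_meet uv.
have Xuv : [disjoint X u & X v].
  by apply: X_disj; case/andP: uv => uv _; apply: contraTneq uv => ->; rewrite eT_irr.
have pXv : p \notin X v by rewrite (disjointFr Xuv).
have /connectP[s pth sq] := Y_conn uv pY qY.
have hs : has (mem (X v)) s.
  case: s pth sq => [_ E|x s _ E]; first by rewrite E (negbTE pXv) in qX.
  by apply/hasP; exists q => //; rewrite E /= mem_last.
pose s1 := take (find (mem (X v)) s) s.
have s1X x : x \in p :: s1 -> x \notin X v.
  rewrite inE => /orP[/eqP->//|] /(nthP p)[i]; rewrite size_take -has_find hs => ilt <-.
  by rewrite nth_take // -[_ \in X v]/(mem (X v) _) before_find.
have := cat_take_drop (find (mem (X v)) s) s; rewrite -/s1.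
rewrite (drop_nth p) -?has_find //; set b := nth _ _ _.
have bX : b \in X v by apply: (nth_find p hs).
set s2 := drop _ _ => sE; rewrite -sE cat_path /= in pth.
case/and3P: pth => pth1 /and3P[ab _ _] _.
have s1Y x : x \in p :: s1 -> x \in Y u v by apply: path_inside_mem.
exists [set x in p :: s1], (last p s1), b; split.
- by apply/fintype.subsetP => x; rewrite !inE -in_cons => xs; rewrite s1X ?s1Y.
- by exists p; rewrite // !inE eqxx.
- suff H x : x \in p :: s1 -> connect (inside [set x in p :: s1]) p x.
    move=> x y; rewrite !inE -!in_cons => xs ys.
    apply: connect_trans (H y ys); rewrite (sym_connect_sym (@inside_sym _)); exact: H.
  by apply: path_connect; apply: path_inside pth1 _ => y; rewrite !inE -in_cons.
- by rewrite !inE -in_cons mem_last.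
- by rewrite bX.
Qed.

(** Each connecting walk is cut before it enters [X v] and is added to [X u]. The resulting sets
    [B u] are connected and disjoint, and the step [a], [b] at the cut represents the edge. *)
Lemma blobs_face_spanned : face_spanned eT.
Proof.
pose good u v (W : {set P}) a b := [/\ W \subset Y u v :\: X v,
  exists2 p, p \in X u & p \in W, conn_in W, a \in W & (b \in X v) && eP a b].
have /fin_all_exists[W] : forall u, exists (W : T -> {set P}) (a b : T -> P), forall v,
    forward u v -> good u v (W v) (a v) (b v).
  move=> u; have [p0 _] := X_neq0 u.
  have /fin_all_exists[W] : forall v, exists (W : {set P}) (a b : P),
      forward u v -> good u v W a b.
    move=> v; case uv: (forward u v); last by exists finset.set0, p0, p0.
    by have [W [a [b ?]]] := connector uv; exists W, a, b.
  by move=> /fin_all_exists[a] /fin_all_exists[b]; exists W, a, b.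
move=> /fin_all_exists[a] /fin_all_exists[b] Wab.
pose B u := X u :|: \bigcup_(v | forward u v) W u v.
pose r p := [pick u | p \in B u].
have WB u v : forward u v -> W u v \subset B u.
  by move=> uv; apply: fintype.subset_trans (finset.subsetUr _ _); apply: (finset.bigcup_sup v).
have XB u : X u \subset B u by apply: finset.subsetUl.
have BP u p : p \in B u -> p \in X u \/ exists2 v, forward u v & p \in W u v.
  by rewrite inE => /orP[|/finset.bigcupP[v]]; [left|right; exists v].
have neqT u v : forward u v -> u != v.
  by case/andP=> uv _; apply: contraTneq uv => ->; rewrite eT_irr.
have WY u v p : forward u v -> p \in W u v -> p \in Y u v /\ p \notin X v.
  move=> uv pW; have [/fintype.subsetP/(_ _ pW) + _ _ _ _] := Wab u v uv.
  by rewrite inE => /andP[].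
have XW u u' v' p : u != u' -> forward u' v' -> p \in X u -> p \in W u' v' -> False.
  move=> uu' uv' pX /(WY _ _ _ uv')[pY pXv'].
  have [E|uv] := eqVneq u v'; first by rewrite -E pX in pXv'.
  by have := disjointFr (XY_disj uv' uu' uv) pY; rewrite pX.
have B_disj u u' p : p \in B u -> p \in B u' -> u = u'.
  move=> /BP pB /BP pB'; apply/eqP; apply: contraT => uu'.
  case: pB pB' => [pX|[v uv pW]] [pX'|[v' uv' pW']].
  - by have := disjointFr (X_disj uu') pX; rewrite pX'.
  - by case: (XW _ _ _ _ uu' uv' pX pW').
  - by case: (XW u' u v p _ uv pX' pW); rewrite eq_sym.
  - have [[pY _] [pY' _]] := (WY _ _ _ uv pW, WY _ _ _ uv' pW').
    have uvN : (u, v) != (u', v') by apply: contra uu' => /eqP[-> _].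
    by have := disjointFr (Y_disj uv uv' uvN) pY; rewrite pY'.
have rP p u : (r p == Some u) = (p \in B u).
  rewrite /r; case: pickP => [u' pB'|none].
    by apply/eqP/idP => [[<-]//|pB]; rewrite (B_disj _ _ _ pB pB').
  by rewrite none.
have toX u p : p \in B u -> exists2 p', p' \in X u & connect (inside (B u)) p p'.
  case/BP=> [pX|[v uv pW]]; first by exists p.
  have [_ [p' p'X p'W] Wc _ _] := Wab _ _ uv; exists p' => //.
  exact: connect_sub_inside (WB _ _ uv) (Wc _ _ pW p'W).
have B_conn u : conn_in (B u).
  move=> p q /toX[p' p'X pp'] /toX[q' q'X qq']; apply: connect_trans pp' _.
  rewrite (sym_connect_sym (@inside_sym _)) in qq'; apply: connect_trans qq'.
  exact: connect_sub_inside (XB u) (X_conn p'X q'X).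
pose dart u v := if enum_rank u < enum_rank v then (a u v, b u v) else (b v u, a v u).
have dartP u v : eT u v -> [/\ eP (dart u v).1 (dart u v).2, (dart u v).1 \in B u &
    (dart u v).2 \in B v].
  move=> uv; rewrite /dart; case: ifP => [lt|/negbT].
    have fuv : forward u v by rewrite /forward uv.
    have [_ _ _ aW /andP[bX ab]] := Wab _ _ fuv.
    by split=> //=; [apply: (fintype.subsetP (WB _ _ fuv))|apply: (fintype.subsetP (XB v))].
  rewrite -leqNgt leq_eqVlt => /orP[/eqP E|lt].
    by move: uv; rewrite (enum_rank_inj (val_inj E)) eT_irr.
  have fvu : forward v u by rewrite /forward eT_sym uv.
  have [_ _ _ aW /andP[bX ab]] := Wab _ _ fvu.
  split=> /=; first by rewrite eP_sym.
    exact: (fintype.subsetP (XB u)).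
  exact: (fintype.subsetP (WB _ _ fvu)).
have dartC u v : eT u v -> dart v u = ((dart u v).2, (dart u v).1).
  move=> uv; rewrite /dart; case: (ltngtP (enum_rank u) (enum_rank v)) => // E.
  by move: uv; rewrite (enum_rank_inj (val_inj E)) eT_irr.
(* All edges between different fibres are deleted except the chosen darts; the fibres are then
   contracted. *)
pose e' p q := eP p q && ((r p == r q) ||
  [exists u, [exists v, eT u v && (dart u v == (p, q))]]).
have e'_sym : symmetric e'.
  suff H p q : e' p q -> e' q p by move=> p q; apply/idP/idP; apply: H.
  rewrite /e' eP_sym [r p == _]eq_sym => /andP[-> /orP[->//|]].
  case/existsP=> u /existsP[v /andP[uv /eqP E]]; apply/orP; right.
  by apply/existsP; exists v; apply/existsP; exists u; rewrite eT_sym uv (dartC _ _ uv) E eqxx.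
have e'_sub : subrel e' eP by move=> p q /andP[].
have e'_faces := face_spanned_del eP_sym e'_sym e'_sub eP_faces.
apply: (@face_spanned_contract P T e' eT r dart) => //.
- by move=> p; rewrite /e' eP_irr.
- move=> p q; case E : (r p) => [u|] // _ /esym/eqP; move/eqP: E; rewrite !rP => pB qB.
  have := B_conn u p q pB qB; apply: connect_sub => x y /and3P[xy xB yB].
  apply: connect1; rewrite /inner /e' xy.
  by move: xB yB; rewrite -!rP => /eqP-> /eqP->; rewrite eqxx.
- move=> u v uv; have [ab aB bB] := dartP u v uv.
  split; [|by apply/eqP; rewrite rP|by apply/eqP; rewrite rP].
  rewrite /e' ab; apply/orP; right; apply/existsP; exists u; apply/existsP; exists v.
  by rewrite uv -surjective_pairing eqxx.
- move=> p q /andP[_ /orP[->//|]] /existsP[u /existsP[v /andP[uv /eqP E]]] _.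
  by exists u, v.
Qed.

End Blobs.

(** * Discretization of curves *)

Section Separation.
Import Order.TTheory GRing.Theory Num.Theory numFieldNormedType.Exports.
Local Open Scope ring_scope.
Local Open Scope classical_set_scope.
Variable R : realType.

(** Each point of [A] has a ball missing the closed set [B]; compactness of [A] makes the radius
    uniform. *)
Lemma compact_separated (A B : set (R * R)) : compact A -> compact B ->
    A `&` B = set0 ->
  \forall h \near 0^'+, forall a b, A a -> B b -> ~ ball a (2 * h) b.
Proof.
move=> cA cB AB0.
have clB : closed B by apply: compact_closed cB; exact: norm_hausdorff.
have : \forall h \near 0^'+, A `<=` [set a | forall b, B b -> ~ ball a (2 * h) b].
  move/compact_near_coveringP : cA => /(_ R 0^'+ (fun h a => forall b, B b -> ~ ball a (2 * h) b)).
  apply=> a Aa.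
  have nBa : ~ B a by move=> Ba; have : (A `&` B) a by []; rewrite AB0.
  have : nbhs a (~` B) by apply: open_nbhs_nbhs; split=> //; exact: closed_openC.
  rewrite -nbhs_ballE => -[e /= e0 eB].
  exists (ball a (e / 2), [set h | h < e / 4]) => /=.
    split; first by apply: nbhsx_ballx; rewrite divr_gt0.
    by apply: nbhs_right_lt; rewrite divr_gt0.
  move=> [a' h] /= [aa' he] b Bb a'b; apply: (eB b) => //.
  apply: (@le_ball _ _ _ (e / 2 + 2 * h)); first by lra.
  exact: ball_triangle aa' a'b.
by apply: filterS => h H a b Aa; apply: H.
Qed.

Lemma compact_box (A : set (R * R)) : compact A ->
  \forall M \near +oo, forall p, A p -> `|p.1| <= M /\ `|p.2| <= M.
Proof.
move=> /compact_bounded[M [Mr HM]]; exists M; split=> // x Mx p Ap.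
by have := HM x Mx p Ap; rewrite /= prod_normE ge_max => /andP[].
Qed.

(** Otherwise the indicator of the failure of [Q] would be continuous and take the value 1/2. *)
Lemma segment_const (Q : R -> Prop) (a b : R) : a <= b ->
    (forall t : R, t \in `[a, b]%R -> \forall t' \near t, t' \in `[a, b]%R -> (Q t' <-> Q t)) ->
  Q a -> Q b.
Proof.
move=> ab locQ Qa; apply: contrapT => Qb.
pose f t : R := if `[< Q t >] then 0 else 1.
have f_cont : {within `[a, b], continuous f}.
  apply/subspace_continuousP => t tab; apply: cvg_near_cst.
  rewrite near_withinE; apply: filterS (locQ t (tab : t \in `[a, b]%R)) => t' Qt t'ab; rewrite /f.
  by congr (if _ then _ else _); apply: asbool_equiv_eq; apply: Qt.
have [|c _ fc] := IVT (v := 2^-1) ab f_cont.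
  rewrite /f (asboolT Qa) (asboolF Qb) minElt maxElt ltr01; lra.
by move: fc; rewrite /f; case: ifP => _; lra.
Qed.

End Separation.

(** * Grid points near a curve *)

Section Blob.
Import Order.TTheory GRing.Theory Num.Theory numFieldNormedType.Exports.
Local Open Scope ring_scope.
Variables (R : realType) (M h : R) (N : nat).
Local Notation P := ('I_N.+1 * 'I_N.+1)%type.

(* The grid point [p] stands for [(p.1 * h - M, p.2 * h - M)]. *)
Definition corner (p : P) (s : R * R) :=
  (`|p.1%:R - (s.1 + M) / h| < 1) && (`|p.2%:R - (s.2 + M) / h| < 1).

Definition blob (S : set (R * R)) : {set P} := [set p | `[< exists2 s, S s & corner p s >]].

Hypotheses (h_gt0 : 0 < h) (N_ge : (M + M) / h <= N%:R).

Lemma blobP (S : set (R * R)) p : reflect (exists2 s, S s & corner p s) (p \in blob S).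
Proof. by rewrite inE; apply: asboolP. Qed.

Lemma common_index (x y : R) : 0 <= x <= N%:R -> 0 <= y <= N%:R -> `|x - y| < 1 ->
  exists i : 'I_N.+1, `|i%:R - x| < 1 /\ `|i%:R - y| < 1.
Proof.
wlog xy : x y / x <= y.
  move=> H x0 y0 xy1; have [|/ltW] := leP x y; first by move/H; apply.
  by move/H => /(_ y0 x0); rewrite distrC => /(_ xy1)[i [? ?]]; exists i.
move=> /andP[x0 xN] /andP[y0 yN]; rewrite ltr_norml => /andP[xy1 _].
(* The integer part of the larger number is within 1 of both. *)
have /andP[ty yt] := Num.Theory.truncn_itv y0.
have tN : (Num.truncn y < N.+1)%N by rewrite ltnS -(ler_nat R); apply: le_trans yN.
exists (Ordinal tN); rewrite /= !ltr_norml; move: yt; rewrite -natr1.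
by split; lra.
Qed.

Lemma common_corner (s s' : R * R) :
    `|s.1| <= M -> `|s.2| <= M -> `|s'.1| <= M -> `|s'.2| <= M -> ball s h s' ->
  exists p : P, corner p s /\ corner p s'.
Proof.
have box (x : R) : `|x| <= M -> 0 <= (x + M) / h <= N%:R.
  rewrite ler_norml => /andP[x1 x2]; apply/andP; split.
    by apply: divr_ge0; [lra|exact: ltW].
  by apply: le_trans N_ge; rewrite ler_pM2r ?invr_gt0 //; lra.
have close (x y : R) : `|x - y| < h -> `|(x + M) / h - (y + M) / h| < 1.
  move=> xy; rewrite -mulrBl normrM [`|h^-1|]gtr0_norm ?invr_gt0 //.
  by rewrite ltr_pdivrMr // mul1r; congr (_ < _): xy; congr `|_|; ring.
move=> s1 s2 s1' s2' [b1 b2].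
have [i [i1 i2]] := common_index (box _ s1) (box _ s1') (close _ _ b1).
have [j [j1 j2]] := common_index (box _ s2) (box _ s2') (close _ _ b2).
by exists (i, j); rewrite /corner /= i1 i2 j1 j2.
Qed.

(** Makes the blobs of sets separated by [2 * h] disjoint. *)
Lemma corner_ball p s s' : corner p s -> corner p s' -> ball s (2 * h) s'.
Proof.
have far (i : nat) (x y : R) : `|i%:R - (x + M) / h| < 1 -> `|i%:R - (y + M) / h| < 1 ->
    `|x - y| < 2 * h.
  move=> xi yi; have -> : x - y = ((i%:R - (y + M) / h) - (i%:R - (x + M) / h)) * h.
    by field; rewrite gt_eqF.
  rewrite normrM [`|h|]gtr0_norm // ltr_pM2r //.
  by apply: le_lt_trans (ler_normB _ _) _; lra.
by move=> /andP[p1 p2] /andP[q1 q2]; split; [exact: far p1 q1|exact: far p2 q2].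
Qed.

(** The two indices differ by at most 1 in each coordinate, and the mixed point [(a', b)] is again a
    corner of [s]. *)
Lemma corners_connected (S : set (R * R)) p q s : S s -> corner p s -> corner q s ->
  connect (inside (@grid_adj N) (blob S)) p q.
Proof.
move=> Ss ps qs.
have idx (i j : 'I_N.+1) (x : R) : `|i%:R - x| < 1 -> `|j%:R - x| < 1 ->
    [\/ i = j, i.+1 = j :> nat | j.+1 = i :> nat] :> Prop.
  move=> ix jx; have ij : `|i%:R - j%:R| < 2 :> R.
    have -> : i%:R - j%:R = (i%:R - x) - (j%:R - x) :> R by ring.
    by apply: le_lt_trans (ler_normB _ _) _; lra.
  have [lt|gt|eq] := ltngtP i j; last by constructor 1; apply: val_inj.
    constructor 2; apply/eqP; rewrite eqn_leq lt /= -ltnS -(ltr_nat R).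
    by move: ij; rewrite distrC ltr_norml -!natr1; lra.
  constructor 3; apply/eqP; rewrite eqn_leq gt /= -ltnS -(ltr_nat R).
  by move: ij; rewrite ltr_norml -!natr1; lra.
case: p q ps qs => [a b] [a' b'] /andP[/= pa pb] /andP[/= qa qb].
have inb (p : P) : corner p s -> p \in blob S by move=> ps; apply/blobP; exists s.
have m1 : (a, b) \in blob S by apply: inb; rewrite /corner /= pa pb.
have m2 : (a', b) \in blob S by apply: inb; rewrite /corner /= qa pb.
have m3 : (a', b') \in blob S by apply: inb; rewrite /corner /= qa qb.
apply: (@connect_trans _ _ (a', b)).
  have [->|E|E] := idx _ _ _ pa qa; first exact: connect0.
    by apply: connect1; rewrite /inside m1 m2 /grid_adj /= -E !eqxx ?orbT.
  by apply: connect1; rewrite /inside m1 m2 /grid_adj /= -E !eqxx ?orbT.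
have [->|E|E] := idx _ _ _ pb qb; first exact: connect0.
  by apply: connect1; rewrite /inside m2 m3 /grid_adj /= -E !eqxx ?orbT.
by apply: connect1; rewrite /inside m2 m3 /grid_adj /= -E !eqxx ?orbT.
Qed.

Local Open Scope classical_set_scope.

(** Nearby points of the curve share a corner, so being connected to the corners of [f a] is a
    locally constant property of the parameter. *)
Lemma blob_curve_conn (f : R -> R * R) (a b : R) :
    {within `[a, b], continuous f} ->
    (forall t, t \in `[a, b]%R -> `|(f t).1| <= M /\ `|(f t).2| <= M) ->
  conn_in (@grid_adj N) (blob (f @` `[a, b])).
Proof.
move=> cf fM; set B := blob _.
have adjs := @inside_sym _ _ (@grid_adj_sym N) B.
have [ab|ba] := leP a b; last first.
  move=> p q /blobP[s [t /=]]; rewrite in_itv /= => /andP[at_ tb].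
  by move: (le_lt_trans (le_trans at_ tb) ba); rewrite ltxx.
have ff t : t \in `[a, b]%R -> (f @` `[a, b]) (f t) by move=> tI; exists t.
have share t t' : t \in `[a, b]%R -> t' \in `[a, b]%R -> ball (f t) h (f t') ->
    exists p, corner p (f t) /\ corner p (f t').
  by move=> /fM[? ?] /fM[? ?]; apply: common_corner.
have aI : a \in `[a, b]%R by rewrite in_itv /= lexx.
have link t : t \in `[a, b]%R -> forall p q, corner p (f a) -> corner q (f t) ->
    connect (inside (@grid_adj N) B) p q.
  move=> tI; have /andP[at_ tb] : a <= t <= b by rewrite in_itv in tI.
  pose Q u := forall p q, corner p (f a) -> corner q (f u) -> connect (inside (@grid_adj N) B) p q.
  apply: (@segment_const _ Q a t) => //; last first.
    by move=> p q pa qa; apply: corners_connected pa qa; apply: ff.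
  move=> u uI; have uI' : u \in `[a, b]%R.
    by move: uI; rewrite !in_itv /= => /andP[-> ut]; apply: le_trans tb.
  have /subspace_continuousP/(_ u uI') cu := cf.
  have : nbhs (f u) (ball (f u) h) by apply: nbhsx_ballx.
  move=> /cu; rewrite /nbhs /= /within /=; apply: filterS => v vB vI.
  have vI' : v \in `[a, b]%R.
    by move: vI; rewrite !in_itv /= => /andP[-> vt]; apply: le_trans tb.
  have [r [ru rv]] := share _ _ uI' vI' (vB vI').
  split=> Qx p q pa qx.
    apply: connect_trans (Qx _ _ pa rv) _; exact: corners_connected (ff _ uI') ru qx.
  apply: connect_trans (Qx _ _ pa ru) _; exact: corners_connected (ff _ vI') rv qx.
move=> p q /blobP[s [t tI <-] ps] /blobP[s' [t' tI' <-] qs'].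
have [r [ra _]] := share _ _ aI aI (ballxx _ h_gt0).
apply: connect_trans (link _ tI' _ _ ra qs').
by rewrite (sym_connect_sym adjs); apply: link ra ps.
Qed.

End Blob.

(** * Planar drawings *)

Section PlanarFaces.
Import Order.TTheory GRing.Theory Num.Theory numFieldNormedType.Exports.
Local Open Scope ring_scope.
Local Open Scope classical_set_scope.
Variables (R : realType) (G : sgraph) (pos : G -> R * R) (arc : G -> G -> R -> R * R).
Hypothesis drawing : plane_drawing pos arc.

(* For non-adjacent [v] and [u], in particular for [u = v], the curve is the
   constant [pos v]: so [pos v] lies on some [curve v u] even if [v] is isolated. *)
Definition curve (v u : G) : R -> R * R := if adj v u then arc v u else fun=> pos v.

(** [false] selects the initial third and [true] the middle one; the final third of [arc u v] is the
    initial third of [arc v u]. *)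
Definition lo (b : bool) : R := if b then 3^-1 else 0.
Definition hi (b : bool) : R := if b then 2 / 3 else 3^-1.
Definition piece (i : bool * G * G) : set (R * R) :=
  curve i.1.2 i.2 @` `[lo i.1.1, hi i.1.1].

Lemma lohi b t : t \in `[lo b, hi b]%R -> t \in `[0, 1]%R.
Proof. by rewrite !in_itv /= /lo /hi; case: b => /andP[? ?]; apply/andP; split; lra. Qed.

Lemma piece_continuous i : {within `[lo i.1.1, hi i.1.1], continuous (curve i.1.2 i.2)}.
Proof.
case: i => [[b v] u] /=; rewrite /curve; case: ifP => [vu|_].
  apply: continuous_subspaceW (arc_continuous drawing vu) => t /= tI; exact: lohi tI.
by apply: continuous_subspaceT => x; apply: cvg_cst.
Qed.

Lemma piece_compact i : compact (piece i).
Proof. by apply: continuous_compact; [exact: piece_continuous|exact: segment_compact]. Qed.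

Lemma interior_meet u v x y (s t : R) : adj u v -> adj x y ->
    s \in `]0, 1[%R -> t \in `[0, 1]%R -> arc u v s = arc x y t ->
  ((x, y) = (u, v)) \/ ((x, y) = (v, u) /\ t = 1 - s).
Proof.
move=> uv xy sI tI st.
have [t0|t0] := eqVneq t 0.
  by case: (arc_vertex drawing (w := x) uv sI); rewrite st t0 (arc_start drawing xy).
have [t1|t1] := eqVneq t 1.
  by case: (arc_vertex drawing (w := y) uv sI); rewrite st t1 (arc_end drawing xy).
have tI' : t \in `]0, 1[%R.
  move: tI; rewrite !in_itv /= => /andP[ge le].
  by rewrite lt_neqAle eq_sym t0 ge lt_neqAle t1 le.
have [->|n1] := eqVneq (x, y) (u, v); first by left.
have [[xv yu]|n2] := eqVneq (x, y) (v, u); last first.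
  by case: (arc_arc drawing uv xy n1 n2 sI tI').
right; subst x y; split=> //; move: st; rewrite (arc_rev drawing uv tI) => /(arc_inj drawing uv) ->.
- by rewrite opprB addrC subrK.
- by apply: subset_itvW sI.
- by move: tI; rewrite !in_itv /= => /andP[? ?]; apply/andP; split; lra.
Qed.

Lemma piece_point b v u p : piece (b, v, u) p ->
  p = pos v /\ (b -> ~~ adj v u) \/
  adj v u /\ exists2 t, t \in `]0, 1[%R & t <= hi b /\ p = arc v u t.
Proof.
case=> t /= tI <-; rewrite /curve; case: ifP => [vu|_]; last by left.
have [t0|t0] := eqVneq t 0; [left|right; split=> //].
  rewrite t0 (arc_start drawing vu); split=> //.
  by move: tI; rewrite t0 in_itv /= /lo; case: b => //=; lra.
exists t; last by split=> //; move: tI; rewrite in_itv /= => /andP[].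
have := lohi tI; rewrite !in_itv /= lt_neqAle eq_sym t0 => /andP[-> _] /=.
by move: tI; rewrite in_itv /= => /andP[_]; rewrite /hi; case: b => /=; lra.
Qed.

(** The critical case is one edge seen from both ends: there [t = 1 - s], which fails for parameters
    at most 1/3. *)
Lemma pieces_disjoint v w x y : v != w -> piece (false, v, x) `&` piece (false, w, y) = set0.
Proof.
move=> vw; rewrite -subset0 => p [/piece_point pv /piece_point pw].
case: pv pw => [[-> _]|[vx [s sI [sh ->]]]] [[pw _]|[wy [t tI [th pw]]]].
- by move/(pos_inj drawing): pw vw => ->; rewrite eqxx.
- by have := arc_vertex drawing wy tI; apply; rewrite -pw.
- by have := arc_vertex drawing vx sI; apply; rewrite pw.
- have tI' : t \in `[0, 1]%R by apply: subset_itvW tI.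
  case: (interior_meet vx wy sI tI' pw) => [[wv _]|[[_ _] ts]].
    by rewrite wv eqxx in vw.
  by move: sh th; rewrite ts /hi; lra.
Qed.

Lemma mid_piece_disjoint u v w y : adj u v -> w != u -> w != v ->
  piece (true, u, v) `&` piece (false, w, y) = set0.
Proof.
move=> uv wu wv; rewrite -subset0 => p [/piece_point pv /piece_point pw].
case: pv => [[_ /(_ isT)]|[_ [s sI [_ ps]]]]; first by rewrite uv.
case: pw => [[pw _]|[wy [t tI [_ pt]]]].
  by have := arc_vertex drawing uv sI; apply; rewrite -ps pw.
have tI' : t \in `[0, 1]%R by apply: subset_itvW tI.
have [] := interior_meet uv wy sI tI' (etrans (esym ps) pt).
  by case=> E; rewrite E eqxx in wu.
by case=> -[E]; rewrite E eqxx in wv.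
Qed.

Lemma mids_disjoint u v x y : adj u v -> adj x y -> (x, y) != (u, v) -> (x, y) != (v, u) ->
  piece (true, u, v) `&` piece (true, x, y) = set0.
Proof.
move=> uv xy n1 n2; rewrite -subset0 => p [/piece_point pv /piece_point pw].
case: pv => [[_ /(_ isT)]|[_ [s sI [_ ps]]]]; first by rewrite uv.
case: pw => [[_ /(_ isT)]|[_ [t tI [_ pt]]]]; first by rewrite xy.
have tI' : t \in `[0, 1]%R by apply: subset_itvW tI.
have [E|[E _]] := interior_meet uv xy sI tI' (etrans (esym ps) pt).
  by rewrite E eqxx in n1.
by rewrite E eqxx in n2.
Qed.

(** There are finitely many pieces, so one bound and one mesh size serve them all. *)
Lemma separated_scale : exists (M h : R) (N : nat),
  [/\ 0 < h, (M + M) / h <= N%:R,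
      forall i p, piece i p -> `|p.1| <= M /\ `|p.2| <= M &
      forall i j, piece i `&` piece j = set0 -> forall a b, piece i a -> piece j b ->
        ~ ball a (2 * h) b].
Proof.
have : \forall M \near +oo%R, forall i p, piece i p -> `|p.1| <= M /\ `|p.2| <= M.
  by apply: filter_forall => i; apply: compact_box; apply: piece_compact.
have : \forall h \near (0 : R)^'+, forall i j, piece i `&` piece j = set0 ->
    forall a b, piece i a -> piece j b -> ~ ball a (2 * h) b.
  apply: filter_forall => i; apply: filter_forall => j.
  have [ij|ij] := pselect (piece i `&` piece j = set0); last by apply: nearW.
  by apply: filterS (compact_separated (@piece_compact i) (@piece_compact j) ij) => h H _.
move=> Hh HM.
near (0 : R)^'+ => h; near (pinfty_nbhs R) => M.
have h0 : 0 < h by near: h; exact: nbhs_right_gt.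
have M0 : 0 <= M by near: M; exact: nbhs_pinfty_ge.
exists M, h, (Num.bound ((M + M) / h)); split=> //.
- by apply/ltW/archi_boundP; rewrite divr_ge0 ?addr_ge0 // ltW.
- by near: M.
- by near: h.
Unshelve. all: by end_near.
Qed.


Local Close Scope classical_set_scope.

Lemma drawing_face_spanned : face_spanned (@adj G).
Proof.
have [M [h [N [h0 Nge box sep]]]] := separated_scale.
pose bl i := blob M h N (piece i).
have bl_sep i j : (piece i `&` piece j = set0)%classic -> [disjoint bl i & bl j].
  move=> ij; rewrite disjoint_subset; apply/fintype.subsetP => p /blobP[s si ps].
  rewrite inE; apply/negP => /blobP[s' sj ps'].
  exact: sep ij _ _ si sj (corner_ball h0 ps ps').
have bl_conn i : conn_in (@grid_adj N) (bl i).
  case: i => [[b v] u]; apply: blob_curve_conn => // [|t tI].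
    exact: (@piece_continuous (b, v, u)).
  by apply: (box (b, v, u)); exists t.
have corner_ex i s : piece i s -> exists p : 'I_N.+1 * 'I_N.+1, corner M h p s.
  move=> /box[s1 s2]; have [p [? _]] := common_corner h0 Nge s1 s2 s1 s2 (ballxx s h0).
  by exists p.
have pos_in v u : piece (false, v, u) (pos v).
  exists 0; first by rewrite /= in_itv /lo /hi /=; apply/andP; split; lra.
  by rewrite /curve; case: ifP => // vu; rewrite (arc_start drawing vu).
have meet1 u v : adj u v -> piece (false, u, v) (arc u v 3^-1) /\ piece (true, u, v) (arc u v 3^-1).
  by move=> uv; split; exists 3^-1; rewrite /curve /= ?uv // in_itv /lo /hi /=;
    apply/andP; split; lra.
have meet2 u v : adj u v ->
    piece (false, v, u) (arc u v (2 / 3)) /\ piece (true, u, v) (arc u v (2 / 3)).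
  move=> uv; have vu : adj v u by rewrite adj_sym.
  split; last first.
    by exists (2 / 3); rewrite /curve /= ?uv // in_itv /lo /hi /=; apply/andP; split; lra.
  exists 3^-1; first by rewrite /= in_itv /lo /hi /=; apply/andP; split; lra.
  rewrite /curve /= vu (arc_rev drawing uv); first by congr arc; field.
  by rewrite in_itv /=; lra.
have in_bl i s p : piece i s -> corner M h p s -> p \in bl i by move=> si ps; apply/blobP; exists s.
(* The initial thirds at [v] all contain [pos v], hence their blobs have a connected union. *)
apply: (@blobs_face_spanned _ _ _ _ (@grid_adj_sym N) (@grid_adj_irr N) (@adj_sym G) (@adj_irrefl G)
  (grid_face_spanned N) (fun v => [set p | [exists u, p \in bl (false, v, u)]])
  (fun u v => bl (true, u, v))).
- move=> v; have [p pv] := corner_ex _ _ (pos_in v v); exists p; rewrite inE.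
  by apply/existsP; exists v; apply: in_bl pv.
- move=> v p q; rewrite !inE => /existsP[x px] /existsP[y qy].
  have [r rv] := corner_ex _ _ (pos_in v v).
  have sub z : bl (false, v, z) \subset [set p | [exists u, p \in bl (false, v, u)]].
    by apply/fintype.subsetP => t tz; rewrite inE; apply/existsP; exists z.
  apply: (@connect_trans _ _ r).
    apply: connect_sub_inside (sub x) _; apply: bl_conn => //.
    exact: in_bl (pos_in v x) rv.
  apply: connect_sub_inside (sub y) _; apply: bl_conn => //.
  exact: in_bl (pos_in v y) rv.
- move=> u v uv; rewrite disjoint_subset; apply/fintype.subsetP => p.
  rewrite !inE => /existsP[x px]; apply/existsP => -[y py].
  by have := disjointFr (bl_sep _ _ (pieces_disjoint x y uv)) px; rewrite py.
- by move=> u v _; apply: bl_conn.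
- move=> u v /andP[uv _]; have [a1 a2] := meet1 u v uv; have [b1 b2] := meet2 u v uv.
  have [p ps] := corner_ex _ _ a1; have [q qs] := corner_ex _ _ b1.
  split; [exists p; last exact: in_bl ps|exists q; last exact: in_bl qs];
    rewrite inE; apply/existsP; [exists v|exists u].
    exact: in_bl ps.
  exact: in_bl qs.
- move=> u v w /andP[uv _] wu wv; rewrite disjoint_subset; apply/fintype.subsetP => p pY.
  rewrite !inE; apply/existsP => -[y py].
  by have := disjointFr (bl_sep _ _ (mid_piece_disjoint y uv wu wv)) pY; rewrite py.
- move=> u v x y /andP[uv ruv] /andP[xy rxy] neq; apply: bl_sep; apply: mids_disjoint => //.
    by rewrite eq_sym.
  by apply/eqP => -[xv yu]; move: rxy; rewrite xv yu ltnNge ltnW.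
Qed.

End PlanarFaces.

(** * The average degree of planar graphs *)

Section Sparse.
Import Order.TTheory GRing.Theory Num.Theory.
Variables (R : realType) (G : sgraph).

Definition induced_adj (S : {set G}) : rel {x | x \in S} :=
  fun x y => adj (val x) (val y).

Lemma induced_adj_sym S : symmetric (@induced_adj S).
Proof. by move=> x y; apply: adj_sym. Qed.

Lemma induced_adj_irr S : irreflexive (@induced_adj S).
Proof. by move=> x; apply: adj_irrefl. Qed.

Definition induced (S : {set G}) : sgraph :=
  SGraph (@induced_adj_sym S) (@induced_adj_irr S).

Lemma induced_drawing S pos arc : @plane_drawing R G pos arc ->
  @plane_drawing R (induced S) (fun v => pos (val v)) (fun u v => arc (val u) (val v)).
Proof.
case=> p1 p2 p3 p4 p5 p6 p7 p8.
split=> [|u v|u v|u v|u v|u v t|u v w t|u v x y s t uv xy n1 n2].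
- by move=> u v /p1/val_inj.
- exact: p2.
- exact: p3.
- exact: p4.
- exact: p5.
- exact: p6.
- exact: p7.
- exact: p8.
Qed.

Lemma induced_degree S (v : induced S) : #|[pred w | induced_adj v w]| = dg (@adj G) S (val v).
Proof.
rewrite /dg -(card_imset _ val_inj); apply: eq_card => w; rewrite !inE.
apply/imsetP/andP => [[x]|[wS vw]]; first by rewrite inE => vx ->; split; first exact: valP.
by exists (Sub w wS) => //; rewrite inE.
Qed.

Hypotheses (G_planar : planar R G)
  (G_girth : (7%:R%:E <= girth R G)%E).

Lemma cycle_ge7 c : @is_cycle G c -> 7 <= size c.
Proof.
move=> cP; have : ((size c)%:R%:E >= girth R G)%E.
  by apply: ereal_inf_lbound; exists c.
by move/(le_trans G_girth); rewrite lee_fin ler_nat.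
Qed.

(** The induced subgraph inherits drawing and girth, so [m < n] or [5 m + 14 <= 7 n]; its degrees
    sum to [2 m]. *)
Lemma planar_sparse (S : {set G}) : S != finset.set0 ->
  5 * \sum_(v in S) dg (@adj G) S v < 14 * #|S|.
Proof.
case/set0Pn => v0 v0S; have [pos [arc drawing]] := G_planar.
have faces := drawing_face_spanned (induced_drawing S drawing).
have n_eq : #|[the finType of {x | x \in S}]| = #|S| by apply: card_sig.
have girthS (c : seq (induced S)) : 2 < size c -> ucycle (@adj (induced S)) c -> 7 <= size c.
  move=> c2 /andP[cc cu]; rewrite -(size_map val); apply: cycle_ge7; split.
    by rewrite size_map.
  by rewrite /ucycle map_inj_uniq ?cu ?andbT; [rewrite cycle_map|exact: val_inj].
have n0 : 0 < #|induced S| by apply/card_gt0P; exists (Sub v0 v0S).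
have := edge_bound (@adj_sym (induced S)) (@adj_irrefl (induced S)) faces
  (fun z zE => even_chain_girth (@adj_sym _) (@adj_irrefl _) girthS zE) n0.
have := card_darts_upper (@adj_sym (induced S)) (@adj_irrefl (induced S)).
rewrite card_darts (eq_bigr (fun v => dg (@adj G) S (val v))) => [|v _]; last exact: induced_degree.
have -> : \sum_(v : induced S) dg (@adj G) S (val v) = \sum_(v in S) dg (@adj G) S v.
  by rewrite (big_sub (mem S)).
rewrite -n_eq -[#|[the finType of _]|]/#|induced S|.
move: #|upper (@adj (induced S))| #|induced S| n0 => m n n0 ->; lia.
Qed.

End Sparse.

Theorem corollary6 (R : realType) (G : sgraph)
  (G_planar : planar R G)
  (G_girth : (7%:R%:E <= girth R G)%E)
  (G_degree : (6 <= max_degree G)%N) :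
  (list_chromatic2 G <= max_degree G + 3)%N.
Proof.
rewrite /list_chromatic2; case: ex_minnP => k _; apply; apply/asboolP => C L L_size.
have size_L v : max_degree G + 2 < #|L v| by rewrite -addnS; apply: L_size.
have /fin_all_exists[phi0 phi0L] : forall v, exists c, c \in L v.
  by move=> v; apply/card_gt0P; apply: leq_trans (size_L v).
have no_triangle x y z : adj x y -> adj y z -> @adj G z x = false.
  move=> xy yz; apply/negP => zx.
  have neq (a b : G) : adj a b -> a != b by apply: contraTneq => ->; rewrite adj_irrefl.
  suff /(cycle_ge7 G_girth) : is_cycle [:: x; y; z] by [].
  by split=> //; rewrite /ucycle /= xy yz zx !inE negb_or neq // [x == z]eq_sym neq // neq.
(* Induction on the size makes all [S :\ c] colourable, as [not_sparse] requires; its bound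
   contradicts [planar_sparse]. *)
have colorable n (S : {set G}) : #|S| <= n -> square_colorable (@adj G) L S.
  elim: n S => [|n IH] S S_le.
    exists phi0; split=> // u v; move: S_le; rewrite leqn0 cards_eq0 => /eqP->.
    by rewrite inE.
  apply: contrapT => S_bad.
  have S_neq0 : S != finset.set0.
    by apply: contra_notN S_bad => /eqP->; apply: IH; rewrite cards0.
  have dg_le v : dg (@adj G) S v <= max_degree G.
    apply: leq_trans (leq_bigmax v); apply: subset_leq_card.
    by apply/fintype.subsetP => w; rewrite !inE => /andP[].
  have S_min c : c \in S -> square_colorable (@adj G) L (S :\ c).
    by move=> cS; apply: IH; rewrite -ltnS (leq_trans _ S_le) // [X in _ < X](cardsD1 c) cS.
  have := not_sparse (@adj_sym G) (@adj_irrefl G) G_degree dg_le size_L S_min S_bad no_triangle.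
  by rewrite leqNgt (planar_sparse G_planar G_girth).
have [phi [phiL phiP]] := colorable _ [set: G] (leqnn _).
exists phi => // u v uv [p [pth pv p2]]; apply: phiP => //.
rewrite !inE eq_sym uv /=.
case: p pth pv p2 => [|x [|y []]] //=.
- by move=> _ uv'; rewrite uv' eqxx in uv.
- by rewrite andbT => ux <- _; rewrite ux.
- rewrite andbT => /andP[ux xy] <- _; apply/orP; right.
  by apply/existsP; exists x; rewrite inE ux.
Qed.
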